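(* There is an absolute constant $C>0$ such that the following holds. Let $G$ be a uniformly random simple $d$-regular graph on $n$ vertices. Let $\mathcal{I}$ be a collection of cycles in the complete graph $K_n$ (on the same vertex set) of maximum length $r$, and let $\mathbf{I}=(I_\alpha,\ \alpha\in\mathcal{I})$ with $I_\alpha=\mathbf{1}\{G\text{ contains }\alpha\}$. Let $\mathbf{Z}=(Z_\alpha,\ \alpha\in\mathcal{I})$ be a vector of independent Poisson random variables with $\mathbb{E}Z_\alpha=(d-1)^{|\alpha|}/[n]_{|\alpha|}$, where $|\alpha|$ is the length of $\alpha$. Then for all $n$ and all $d,r\geq 3$ with $r\leq n^{1/10}$ and $d\leq n^{1/3}$, \[ d_{TV}(\mathbf{I},\mathbf{Z})\leq \sum_{\alpha\in\mathcal{I}}\frac{C\,|\alpha|(d-1)^{|\alpha|+r-1}}{n^{|\alpha|+1}}. \]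
   Context: A random $d$-regular graph on $n$ vertices is chosen uniformly from all simple $d$-regular graphs on $\{1,\dots,n\}$ (with $n$ even when $d$ is odd). Cycles are simple cycles. $[n]_k=n(n-1)\cdots(n-k+1)$. For random vectors $X,Y$ with values in a countable set $S$, $d_{TV}(X,Y)=\sup_{A\subset S}|\mathbb{P}[X\in A]-\mathbb{P}[Y\in A]|$. *)

(* Defs.v *)
From HB Require Import structures.
From mathcomp Require Import all_boot all_order all_algebra.

Set Implicit Arguments.
Unset Strict Implicit.
Unset Printing Implicit Defensive.

(* Subgraphs of K_n, and in particular cycles, are identified with their edge
   sets; the vertex set {1, ..., n} is represented by 'I_n. *)
Definition edge_set (n : nat) : Type := {set {set 'I_n}}.
HB.instance Definition _ n := Finite.on (edge_set n).

Section Graphs.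
Variable n : nat.
Implicit Types (E : edge_set n) (c : seq 'I_n).

Definition simple_graph E : bool := [forall e in E, #|e| == 2].

Definition degree E (v : 'I_n) : nat := #|[set e in E | v \in e]|.

Definition is_regular (d : nat) E : bool :=
  simple_graph E && [forall v, degree E v == d].

Definition regular_graphs (d : nat) : {set edge_set n} :=
  [set E : edge_set n | is_regular d E].

(* c = [:: v_1; ...; v_k] gives {v_1,v_2}, ..., {v_{k-1},v_k}, {v_k,v_1}. *)
Definition cycle_edges c : edge_set n := [set [set v; next c v] | v in c].

Definition is_cycle E : Prop :=
  exists c, [/\ uniq c, 3 <= size c & E = cycle_edges c].

Definition cycle_length E : nat := #|E|.

Definition contains (G E : edge_set n) : bool := E \subset G.

End Graphs.

From mathcomp Require Import all_classical all_reals all_analysis.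

Import Order.TTheory GRing.Theory Num.Theory.
Local Open Scope classical_set_scope.
Local Open Scope ring_scope.

Section Probability.
Context {R : realType} {dO : measure_display} {Omega : measurableType dO}.
Variable P : probability Omega R.

Definition uniform_on (S : finType) (B : {set S}) (X : Omega -> S) : Prop :=
  forall x : S, measurable (X @^-1` [set x]) /\
    P (X @^-1` [set x]) = (if x \in B then (#|B|%:R)^-1 else 0)%:E.

Definition is_poisson (X : {RV P >-> nat}) : Prop :=
  exists2 rate : R, 0 < rate &
    forall k, P (X @^-1` [set k]) = (poisson_pmf rate k)%:E.

Definition mutually_independent (I : finType) (X : I -> {RV P >-> nat}) : Prop :=
  forall (J : {set I}) (A : I -> set nat),
    P (\bigcap_(i in [set i | i \in J]) (X i @^-1` A i)) =
    (\prod_(i in J) P (X i @^-1` A i))%E.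

End Probability.

(* Meaningful when X and Y are measurable for the discrete sigma-algebra on S;
   the supremum is over a nonempty set of reals bounded by 1. *)
Definition dTV {R : realType} {dO dO2 : measure_display}
    {Omega : measurableType dO} {Omega2 : measurableType dO2}
    (P : probability Omega R) (Q : probability Omega2 R)
    (S : countType) (X : Omega -> S) (Y : Omega2 -> S) : R :=
  sup [set `|fine (P (X @^-1` A)) - fine (Q (Y @^-1` A))| | A in [set: set S]].

Section Vectors.
Variables (n : nat) (cI : {set edge_set n}) (T : Type).

Definition cycle_index : finType := {alpha : edge_set n | alpha \in cI}.

Definition cycle_indicators (G : T -> edge_set n) (w : T) : {ffun cycle_index -> nat} :=
  [ffun alpha : cycle_index => nat_of_bool (contains (G w) (val alpha))].

Definition joint_vector (Z : cycle_index -> T -> nat) (w : T) : {ffun cycle_index -> nat} :=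
  [ffun alpha => Z alpha w].

End Vectors.

(* Main.v *)
Require Import Defs.
From mathcomp Require Import all_boot all_order all_algebra.
From mathcomp Require Import zify ring lra.

Set Implicit Arguments.
Unset Strict Implicit.
Unset Printing Implicit Defensive.

Import Order.TTheory GRing.Theory Num.Theory.
Local Open Scope ring_scope.

(** The edges of a cycle [alpha] are inserted one at a time.  Inserting the edge
    [xy] into a regular graph that contains a fixed edge set [F] is a 2-switch:
    [xu] and [yw] are replaced by [xy] and [uw].  Counting the switches from
    both sides shows that requiring [xy] multiplies the number of graphs by
    about [(d - deg_F x) (d - deg_F y) / (n d)], and the product of these
    factors over [alpha] is [((d - 1) / n) ^ |alpha|].  A switch changes the
    indicator of some other short cycle only if that cycle uses one of the four
    edges involved; closing such a cycle at a suitable edge outside [F] gains a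
    factor [O(d / n)] over the number of paths leading to it, so the proportion
    of these switches is [O((d - 1) ^ (r - 1) / n)].  Hence for every bounded
    [h] depending only on the other cycles, [E (h; alpha in G)] is
    [lambda_alpha E h] up to a relative error
    [O(|alpha| (d - 1) ^ (r - 1) / n)].  This allows the indicators to be
    replaced by independent Poisson variables one coordinate at a time. *)

(** * Switchings *)

(** The factors multiply out exactly: the first edge contributes $d^2/(nd)$, each further path edge
    $d(d-1)/(nd)$ and the closing edge $(d-1)^2/(nd)$, which together make $((d-1)/n)^k$. The
    obstacle is that a switch count has an error proportional to the number of graphs containing the
    edges inserted so far, whereas the comparison is with all regular graphs. So an upper bound of
    twice the ideal product on the former number is carried along the insertions; the bounds on $r$
    and $d$ keep the accumulated loss below that factor 2. For the replacement step, a function $f$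
    of the set $W$ of cycles present is split into $f(W\setminus\alpha)$ and $f(W\cup\alpha)$,
    neither of which depends on $\alpha$, and these are weighted by the Poisson probabilities of 0
    and 1. Values of at least 2 are simply dropped. What results is a lower bound for the law of
    $Z$, hence a one-sided estimate, which passing to complements makes two-sided. *)

Section Switching.
Variables (n d : nat).
Implicit Types (a b c e u v w x y : 'I_n) (F G : edge_set n).

Lemma eq_set2 (T : finType) (a b c e : T) :
  ([set a; b] == [set c; e]) = (a == c) && (b == e) || (a == e) && (b == c).
Proof.
apply/eqP/orP => [E|[] /andP[/eqP-> /eqP->]]; rewrite // 1?[RHS]setUC //.
have: a \in [set c; e] by rewrite -E set21.
have: b \in [set c; e] by rewrite -E set22.
have: c \in [set a; b] by rewrite E set21.
have: e \in [set a; b] by rewrite E set22.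
rewrite !inE ![c == _]eq_sym ![e == _]eq_sym.
by case: (a == c); case: (b == e); case: (a == e); case: (b == c) => //=; auto.
Qed.

Lemma regular_simple G : G \in regular_graphs n d -> simple_graph G.
Proof. by rewrite inE => /andP[]. Qed.

Lemma simple_edge_neq G a b : simple_graph G -> [set a; b] \in G -> a != b.
Proof.
move=> /forallP/(_ [set a; b]) /implyP H /H.
by rewrite cards2; case: (a == b).
Qed.

Lemma degreeE (E : edge_set n) v : degree E v = (\sum_(f in E) (v \in f))%N.
Proof.
rewrite /degree -sum1_card big_mkcond [RHS]big_mkcond /=.
by apply: eq_bigr => f _; rewrite inE; case: (f \in E); case: (v \in f).
Qed.

Lemma sum_neighbours G u : simple_graph G ->
  (\sum_w ([set u; w] \in G) = degree G u)%N.
Proof.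
move=> sG; have -> : (\sum_w ([set u; w] \in G) = #|[set w | [set u; w] \in G]|)%N.
  rewrite -sum1_card [RHS]big_mkcond /=; apply: eq_bigr => w _.
  by rewrite inE; case: ifP.
rewrite /degree -[LHS](card_in_imset (f := fun w => [set u; w])); last first.
  move=> w w'; rewrite !inE => H1 H2 /eqP; rewrite eq_set2 eqxx /=.
  case/orP=> [/eqP//|/andP[/eqP E1 /eqP E2]].
  by rewrite E2.
congr #|pred_of_set _|; apply/setP => f; rewrite !inE; apply/imsetP/andP.
  by case=> w; rewrite inE => H ->; split => //; rewrite set21.
case=> fG uf; have /forallP/(_ f)/implyP/(_ fG)/eqP c2 := sG.
have /cards1P[w Ew] : #|f :\ u| == 1%N.
  by move: c2; rewrite (cardsD1 u f) uf add1n => -[->].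
by exists w; rewrite ?inE -Ew setD1K.
Qed.

Lemma regular_neighbours G u : G \in regular_graphs n d ->
  (\sum_w ([set u; w] \in G) = d)%N.
Proof.
move=> rG; rewrite sum_neighbours ?(regular_simple rG) //.
by move: rG; rewrite inE => /andP[_ /forallP/(_ u)/eqP].
Qed.

Lemma sum_degree G : simple_graph G -> (\sum_u degree G u = 2 * #|G|)%N.
Proof.
move=> sG; under eq_bigr do rewrite degreeE.
rewrite exchange_big /= -sum1_card big_distrr /=; apply: eq_bigr => f fG.
rewrite muln1; have /forallP/(_ f)/implyP/(_ fG)/eqP <- := sG.
rewrite -sum1_card [RHS]big_mkcond; apply: eq_bigr => u _.
by case: (u \in f).
Qed.

(** On the argument order: [switch x u y w] inserts [xy] and [uw], while [switch x y u w] deletes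
    them. *)
Definition switch a b c e G : edge_set n :=
  [set a; c] |: ([set b; e] |: ((G :\ [set a; b]) :\ [set c; e])).

(* Exchanging [b] and [c] turns this condition into the one for the inverse switch. *)
Definition switchable F a b c e G : bool :=
  [&& G \in regular_graphs n d, F \subset G & uniq [:: a; b; c; e]] &&
  [&& [set a; b] \in G :\: F, [set c; e] \in G :\: F,
      [set a; c] \notin G & [set b; e] \notin G].

Lemma switchableP F a b c e G : switchable F a b c e G ->
  [/\ G \in regular_graphs n d, F \subset G, uniq [:: a; b; c; e],
      [/\ [set a; b] \in G, [set a; b] \notin F, [set c; e] \in G
        & [set c; e] \notin F]
    & [set a; c] \notin G /\ [set b; e] \notin G].
Proof.
case/andP=> /and3P[-> -> ->] /and4P[].
by rewrite 2!in_setD => /andP[-> ->] /andP[-> ->] -> ->.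
Qed.

Lemma in_switch a b c e G f :
  f \in switch a b c e G = [|| f == [set a; c], f == [set b; e] |
    [&& f != [set c; e], f != [set a; b] & f \in G]].
Proof. by rewrite !inE. Qed.

Lemma uniq4_set2 a b c e : uniq [:: a; b; c; e] ->
  [/\ [set a; b] != [set c; e], [set a; b] != [set a; c],
      [set a; b] != [set b; e], [set c; e] != [set a; c]
    & [/\ [set c; e] != [set b; e] & [set a; c] != [set b; e]]].
Proof.
rewrite /= !inE !negb_or !andbT => /and3P[/and3P[ab ac ae] /andP[bc be] ce].
rewrite !eq_set2 (eq_sym e a) (eq_sym c a) (eq_sym c b) (eq_sym e b) (eq_sym b a).
by rewrite (negPf ab) (negPf ac) (negPf ae) (negPf bc) (negPf be) (negPf ce) /= ?andbF.
Qed.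

Lemma degree_switch F a b c e G v : switchable F a b c e G ->
  degree (switch a b c e G) v = degree G v.
Proof.
case/switchableP=> rG _ U [ab _ ce _] [ac be].
have [n1 n2 n3 n4 [n5 n6]] := uniq4_set2 U.
rewrite !degreeE /switch.
rewrite big_setU1 /=; last by rewrite !inE (negPf ac) (negPf n6) !andbF.
rewrite big_setU1 /=; last by rewrite !inE (negPf be) !andbF.
rewrite (big_setD1 _ ab) /= (big_setD1 (A := G :\ [set a; b]) [set c; e]) /=;
  last by rewrite in_setD1 ce andbT eq_sym n1.
rewrite !inE; move: U; rewrite /= !inE !negb_or !andbT => /and3P[/and3P[n7 n8 n9] /andP[m1 m2]
  m3].
have D (p q : 'I_n) : p != q -> ((v == p) || (v == q) = (v == p) + (v == q) :> nat)%N.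
  by move=> pq; case: eqP => [->|]; rewrite ?(negPf pq).
by rewrite !D // !addnA [X in (X + _ + _)%N]addnAC.
Qed.

Lemma switchable_switch F a b c e G : switchable F a b c e G ->
  switchable F a c b e (switch a b c e G).
Proof.
move=> ok; case/switchableP: (ok) => rG FG U [ab abF ce ceF] [ac be].
have [n1 n2 n3 n4 [n5 n6]] := uniq4_set2 U.
have FN f : f \notin G -> f \notin F by apply: contra; apply/subsetP.
apply/andP; split; [apply/and3P|apply/and4P]; split.
- rewrite inE; apply/andP; split.
    apply/forall_inP => f; rewrite in_switch.
    case/or3P => [/eqP->|/eqP->|/and3P[_ _ fG]].
    + by move: U => /= /andP[]; rewrite !inE !negb_or cards2 => /and3P[_ -> _].
    + by move: U => /= /and3P[_]; rewrite !inE !negb_or cards2 => /andP[_ ->].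
    + by have /forall_inP/(_ f fG) := regular_simple rG.
  apply/forallP => v; rewrite (degree_switch v ok).
  by move: rG; rewrite inE => /andP[_ /forallP].
- apply/subsetP => f fF; rewrite in_switch (subsetP FG _ fF) andbT.
  by apply/or3P/Or33/andP; split; [apply: contraNneq ceF => <-| apply: contraNneq abF => <-].
- by move: U; rewrite /= !inE !negb_or (eq_sym c b);
  case/and4P=> /and3P[-> -> ->] /andP[-> ->] ->.
- by rewrite inE in_switch eqxx FN.
- by rewrite inE in_switch eqxx orbT FN.
- by rewrite in_switch (negPf n2) (negPf n3) eqxx andbF.
- by rewrite in_switch (negPf n4) (negPf n5) eqxx.
Qed.

Lemma switchK F a b c e G : switchable F a b c e G ->
  switch a c b e (switch a b c e G) = G.
Proof.
move=> ok; case/switchableP: (ok) => rG FG U [ab abF ce ceF] [ac be].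
have [n1 n2 n3 n4 [n5 n6]] := uniq4_set2 U.
apply/setP => f; rewrite !in_switch.
have [->|f1] := eqVneq f [set a; b]; first by rewrite ab.
have [->|f2] := eqVneq f [set c; e]; first by rewrite ce.
have [->|f3] := eqVneq f [set b; e]; first by rewrite (negPf be).
by have [->|f4] := eqVneq f [set a; c]; first by rewrite (negPf ac).
Qed.

(** By [switchK] the two switches are mutually inverse bijections between the two sets of admissible
    graphs. Every double count below is this reindexing. *)
Lemma sum_switch (R : nmodType) F a b c e (f : edge_set n -> R) :
  \sum_(G | switchable F a b c e G) f G =
  \sum_(G | switchable F a c b e G) f (switch a c b e G).
Proof.
rewrite (reindex_onto (switch a c b e) (switch a b c e)); last first.
  by move=> G; apply: switchK.
apply: eq_bigl => G; apply/andP/idP => [[H /eqP <-]|H].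
  exact: switchable_switch H.
by rewrite switchable_switch // (switchK H).
Qed.

End Switching.

(** * Inserting an edge *)

Lemma sum_triple (R : comPzRingType) (I J K : finType) (P : I -> J -> pred K)
    (Q : pred K) (f : K -> R) : (forall i j k, P i j k -> Q k) ->
  \sum_i \sum_j \sum_(k | P i j k) f k =
  \sum_(k | Q k) f k * \sum_i \sum_j (P i j k)%:R.
Proof.
move=> PQ; rewrite [RHS](eq_bigr _ (fun k _ => mulr_sumr _ _ _ _)).
rewrite [RHS]exchange_big /=; apply: eq_bigr => i _.
rewrite [RHS](eq_bigr _ (fun k _ => mulr_sumr _ _ _ _)).
rewrite [RHS]exchange_big /=; apply: eq_bigr => j _.
rewrite big_mkcond [RHS]big_mkcond /=; apply: eq_bigr => k _.
case: (boolP (P i j k)) => [/PQ -> |_]; first by rewrite mulr1.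
by rewrite mulr0; case: ifP.
Qed.

Lemma sum_delta_nat (T : finType) (x : T) (f : T -> nat) :
  (\sum_u (u == x) * f u = f x)%N.
Proof.
rewrite (bigD1 x) //= eqxx mul1n big1 ?addn0 // => u /negPf ->.
by rewrite mul0n.
Qed.

Lemma ler_nat_bool (R : numDomainType) (b c : bool) : (b -> c) -> b%:R <= c%:R :> R.
Proof. by case: b => [->//|_]; rewrite ler0n. Qed.

Section EdgeInsertion.
Variables (R : realFieldType) (n d : nat).
Implicit Types (a b c e u v w x y : 'I_n) (F G : edge_set n).
Local Notation reg := (regular_graphs n d).

Definition graph_sum (f : edge_set n -> R) F : R :=
  \sum_(G in reg | F \subset G) f G.

Definition graph_count F : R := graph_sum (fun=> 1) F.

Lemma graph_count_ge0 F : 0 <= graph_count F.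
Proof. by apply: sumr_ge0. Qed.

Lemma simple_sub F G : F \subset G -> simple_graph G -> simple_graph F.
Proof.
move=> /subsetP FG /forall_inP sG; apply/forall_inP => f /FG; exact: sG.
Qed.

Lemma regular_neighboursR G u : G \in reg ->
  \sum_w ([set u; w] \in G)%:R = d%:R :> R.
Proof. by move=> rG; rewrite -natr_sum (regular_neighbours u rG). Qed.

Lemma regular_neighbours_outside G F u : G \in reg -> F \subset G ->
  \sum_w ([set u; w] \in G :\: F)%:R = d%:R - (degree F u)%:R :> R.
Proof.
move=> rG FG; rewrite -(regular_neighboursR u rG).
rewrite -(sum_neighbours u (simple_sub FG (regular_simple rG))) natr_sum -sumrB.
apply: eq_bigr => w _; rewrite inE; case: (boolP (_ \in F)) => [/(subsetP FG) ->|_] /=.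
  by rewrite subrr.
by rewrite subr0.
Qed.

(** Three things can spoil an ordered edge [uw]: it lies in [F] ([2 * #|F|] pairs), it meets [x] or
    [y] ([4 * d]), or [xu] or [yw] is already present, so that [uw] is the second edge of a walk
    from [x] or, reversed, from [y] ([2 * d ^ 2]). *)
Lemma unswitchable_le G F x y : G \in reg -> F \subset G ->
    [set x; y] \in G :\: F ->
  (\sum_u \sum_w (([set u; w] \in G) && ~~ switchable d F x y u w G)
     <= 2 * #|F| + 4 * d + 2 * d ^ 2)%N.
Proof.
move=> rG FG xyGF; have sG := regular_simple rG.
have xy : x != y by move: xyGF; rewrite inE => /andP[_ /(simple_edge_neq sG)].
pose g u w : nat := ([set u; w] \in G).
have gC u w : g u w = g w u by rewrite /g setUC.
have gd u : (\sum_w g u w = d)%N by apply: regular_neighbours.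
have -> : (2 * #|F| + 4 * d + 2 * d ^ 2 = \sum_u \sum_w (([set u; w] \in F)
    + ((u == x) * g u w + (u == y) * g u w + (w == x) * g u w + (w == y) * g u w)
    + (g x u * g u w + g y w * g u w)))%N.
  have sF := simple_sub FG sG.
  have S1 v : (\sum_u \sum_w (u == v) * g u w = d)%N.
    by under eq_bigr do rewrite -big_distrr gd /=; rewrite (sum_delta_nat v (fun=> d)).
  have S2 v : (\sum_u \sum_w (w == v) * g u w = d)%N.
    rewrite exchange_big /= -[RHS](S1 v); apply: eq_bigr => w _.
    by apply: eq_bigr => u _; rewrite gC.
  have S3 : (\sum_u \sum_w g x u * g u w = d * d)%N.
    by under eq_bigr do rewrite -big_distrr gd /=; rewrite -big_distrl gd.
  have S4 : (\sum_u \sum_w g y w * g u w = d * d)%N.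
    rewrite exchange_big /=; under eq_bigr => w _ do
      under eq_bigr => u _ do rewrite (gC u w).
    by under eq_bigr do rewrite -big_distrr gd /=; rewrite -big_distrl gd.
  under [RHS]eq_bigr do rewrite !big_split /=.
  rewrite !big_split /= !S1 !S2 S3 S4.
  under [X in (_ = X + _ + _)%N]eq_bigr do rewrite (sum_neighbours _ sF).
  by rewrite sum_degree // expnS expn1; ring.
apply: leq_sum => u _; apply: leq_sum => w _; rewrite /g.
case: (boolP (_ \in G)) => //= uwG.
rewrite /switchable rG FG xyGF inE uwG !muln1 !andbT /= !inE.
rewrite (eq_sym x u) (eq_sym x w) (eq_sym y u) (eq_sym y w) (negPf xy) (simple_edge_neq sG uwG).
by case: ([set u; w] \in F); case: (u == x); case: (u == y); case: (w == x);
  case: (w == y); case: (_ \in G); case: (_ \in G).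
Qed.

Lemma switchable_sum_ge G F x y : G \in reg -> F \subset G ->
    [set x; y] \in G :\: F ->
  n%:R * d%:R - (2 * #|F| + 4 * d + 2 * d ^ 2)%:R <=
    \sum_u \sum_w (switchable d F x y u w G)%:R :> R.
Proof.
move=> rG FG xyGF; have := unswitchable_le rG FG xyGF.
rewrite -(ler_nat R) => H; rewrite lerBlDl; apply: le_trans (lerD H (lexx _)).
rewrite natr_sum -big_split /=.
have -> : n%:R * d%:R = \sum_(u < n) d%:R :> R.
  by rewrite sumr_const card_ord mulr_natl.
apply: ler_sum => u _; rewrite natr_sum -big_split /= -(regular_neighboursR u rG).
apply: ler_sum => w _; rewrite -natrD ler_nat.
by case: (_ \in G); case: (switchable _ _ _ _ _ _ _).
Qed.

(** An insertion of [xy] is determined by a neighbour of [x] and a neighbour of [y], each along an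
    edge of [G] outside [F]. *)
Lemma switchable_sum_le G F x y : G \in reg -> F \subset G ->
  \sum_u \sum_w (switchable d F x u y w G)%:R <=
    (d%:R - (degree F x)%:R) * (d%:R - (degree F y)%:R) :> R.
Proof.
move=> rG FG; rewrite -!(regular_neighbours_outside _ rG FG) mulr_suml.
apply: ler_sum => u _; rewrite mulr_sumr; apply: ler_sum => w _.
rewrite -natrM mulnb; apply: ler_nat_bool => /andP[_ /and4P[-> -> _ _]] //.
Qed.

Lemma switchable_edge_sub F x y u w G : switchable d F x y u w G ->
  (G \in reg) && ([set x; y] |: F \subset G).
Proof.
by case/switchableP=> -> FG _ [xy _ _ _] _; rewrite subUset sub1set xy FG.
Qed.

Lemma switchable_sub F x y u w G : switchable d F x y u w G ->
  (G \in reg) && (F \subset G).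
Proof. by case/switchableP=> -> ->. Qed.

(** Double count of switches: each graph containing [xy] and [F] admits at least the left factor
    many deletions of [xy], each graph containing [F] at most the right factor many insertions. *)
Lemma edge_insertion F x y : [set x; y] \notin F ->
  (n%:R * d%:R - (2 * #|F| + 4 * d + 2 * d ^ 2)%:R) * graph_count ([set x; y] |: F)
  <= (d%:R - (degree F x)%:R) * (d%:R - (degree F y)%:R) * graph_count F.
Proof.
move=> xyF; rewrite !(mulr_sumr) /=.
apply: (@le_trans _ _ (\sum_u \sum_w \sum_(G | switchable d F x y u w G) 1)).
  rewrite (sum_triple _ (@switchable_edge_sub F x y)).
  apply: ler_sum => G /andP[rG]; rewrite subUset sub1set => /andP[xyG FG].
  by rewrite mulr1 mul1r switchable_sum_ge // inE xyG xyF.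
rewrite (eq_bigr (fun u => \sum_w \sum_(G | switchable d F x u y w G) 1)); last first.
  by move=> u _; apply: eq_bigr => w _; rewrite sum_switch.
rewrite (sum_triple _ (fun u w => @switchable_sub F x u y w)).
apply: ler_sum => G /andP[rG FG].
by rewrite mulr1 mul1r switchable_sum_le.
Qed.

(** The size condition makes the subtracted term at most half of [n * d], and $d^2/(nd/2) =
    2d/n$. *)
Lemma edge_insertion_crude F (f : {set 'I_n}) : (0 < d)%N -> (0 < n)%N ->
  f \notin F -> (4 * #|F| + 8 * d + 4 * d ^ 2 <= n * d)%N ->
  graph_count (f |: F) <= 2 * d%:R / n%:R * graph_count F.
Proof.
move=> d0 n0 fF K.
have rhs0 : 0 <= 2 * d%:R / n%:R * graph_count F.
  by rewrite mulr_ge0 ?graph_count_ge0 // divr_ge0 ?mulr_ge0 ?ler0n.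
case: (boolP (#|f| == 2%N)) => [/cards2P[x [y [xy E]]]|c2]; last first.
  rewrite /graph_count /graph_sum big1 // => G /andP[/regular_simple/forall_inP sG].
  by rewrite subUset sub1set => /andP[/sG]; rewrite (negPf c2).
(* A regular graph containing [F] forces its degrees to be at most [d], so both factors in
   [edge_insertion] are nonnegative; without such a graph the left side is zero. *)
subst f; have [/existsP[G /andP[rG FG]]|F00] :=
    boolP [exists G, (G \in reg) && (F \subset G)]; last first.
  rewrite /graph_count /graph_sum big1 // => G /andP[rG].
  rewrite subUset => /andP[_ FG]; move: F00.
  by rewrite negb_exists => /forallP/(_ G); rewrite rG FG.
have dF v : (degree F v <= d)%N.
  move: rG; rewrite inE => /andP[_ /forallP/(_ v)/eqP <-].
  by apply: subset_leq_card; apply/subsetP => f; rewrite !inE => /andP[/(subsetP FG)-> ->].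
have := edge_insertion fF.
move: (dF x) (dF y); rewrite -!(ler_nat R).
set K1 := (_ + _)%:R; set c1 := graph_count _; set c0 := graph_count F.
move: (ler0n R (degree F x)) (ler0n R (degree F y)).
move: (degree F x)%:R (degree F y)%:R => p q p0 q0 pd qd H.
have c10 : 0 <= c1 by apply: graph_count_ge0.
have c00 : 0 <= c0 by apply: graph_count_ge0.
have K2 : 2 * K1 <= n%:R * d%:R.
  by rewrite -!natrM ler_nat; clear -K; lia.
have dR : 0 < d%:R :> R by rewrite ltr0n.
have nR : 0 < n%:R :> R by rewrite ltr0n.
have H2 : (d%:R - p) * (d%:R - q) <= d%:R * d%:R by apply: ler_pM; lra.
have H3 : n%:R * d%:R / 2 * c1 <= d%:R * d%:R * c0.
  apply: le_trans (ler_wpM2r c00 H2); apply: le_trans H.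
  by apply: ler_wpM2r => //; lra.
rewrite mulrAC ler_pdivlMr // -(ler_pM2l dR).
by move: H3; lra.
Qed.

End EdgeInsertion.

(** * Paths and cycles as edge sets *)

Section PathEdges.
Variable n : nat.
Implicit Types (a b c e u v w x y h : 'I_n) (F G : edge_set n) (s t p : seq 'I_n).

Fixpoint path_edges s : edge_set n :=
  if s is a :: s' then
    if s' is b :: _ then [set a; b] |: path_edges s' else set0
  else set0.

Arguments path_edges : simpl never.

Lemma path_edges0 : path_edges [::] = set0. Proof. by []. Qed.

Lemma path_edges1 a : path_edges [:: a] = set0. Proof. by []. Qed.

Lemma path_edges_cons2 a b s :
  path_edges [:: a, b & s] = [set a; b] |: path_edges (b :: s).
Proof. by []. Qed.

Definition path_edgesE := (path_edges0, path_edges1, path_edges_cons2).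

Lemma path_edges_cat s1 a s2 :
  path_edges (s1 ++ a :: s2) = path_edges (rcons s1 a) :|: path_edges (a :: s2).
Proof.
elim: s1 => [|b [|c s1] IH] /=; rewrite !path_edgesE.
- by rewrite set0U.
- by rewrite setU0.
- by rewrite -setUA; congr (_ |: _); rewrite -IH.
Qed.

Lemma path_edges_rcons s a b :
  path_edges (rcons (rcons s a) b) = [set a; b] |: path_edges (rcons s a).
Proof.
by rewrite -[rcons (rcons s a) b]cats1 cat_rcons path_edges_cat !path_edgesE setU0 setUC.
Qed.

Lemma path_edges_rev s : path_edges (rev s) = path_edges s.
Proof.
elim: s => // a [|b s] IH //; rewrite path_edges_cons2 -IH.
by rewrite !rev_cons path_edges_rcons; congr (_ |: _); rewrite setUC.
Qed.

Lemma path_edges_mem s f v : f \in path_edges s -> v \in f -> v \in s.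
Proof.
elim: s => [|a [|b s] IH]; rewrite path_edgesE ?in_set0 // in_setU1.
case/orP=> [/eqP->|fs vf]; last by rewrite in_cons (IH fs vf) orbT.
by rewrite !inE; case/orP=> ->; rewrite ?orbT.
Qed.

Lemma card_path_edges s : (#|path_edges s| <= (size s).-1)%N.
Proof.
elim: s => [|a [|b s] IH]; rewrite path_edgesE ?cards0 //.
by rewrite cardsU1 /= -add1n leq_add // leq_b1.
Qed.

Lemma cons2_edge_notin a b s : a \notin b :: s ->
  [set a; b] \notin path_edges (b :: s).
Proof. by apply: contra => H; apply: (path_edges_mem H); rewrite set21. Qed.

Lemma degree_edge F a b v : a != b -> [set a; b] \notin F ->
  degree ([set a; b] |: F) v = ((v == a) + (v == b) + degree F v)%N.
Proof.
move=> ab abE; rewrite !degreeE big_setU1 //= !inE.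
by case: (v =P a) => [->|]; rewrite ?(negPf ab).
Qed.

Lemma degree_path_edges h p v : uniq (h :: p) ->
  degree (path_edges (h :: p)) v = ((v \in p) + (v \in belast h p))%N.
Proof.
elim: p h => [|b p IH] h.
  by move=> _; rewrite degreeE path_edgesE big_set0.
rewrite path_edges_cons2 cons_uniq => /andP[hbp U].
rewrite degree_edge; last exact: cons2_edge_notin; last first.
  by apply: contraNneq hbp => ->; rewrite mem_head.
rewrite IH // in_cons /= in_cons.
have [->|] := eqVneq v b; rewrite /= ?add0n.
  have -> : b \in p = false by move: U => /= /andP[/negPf].
  by rewrite eq_sym; case: eqP hbp => [->|]; rewrite ?mem_head //= addn0 add0n.
have [->|vh] := eqVneq v h => vb //=.
have hp : h \notin p by move: hbp; rewrite in_cons negb_or => /andP[].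
rewrite (negPf hp) /=; case: (boolP (h \in _)) => // /mem_belast.
by rewrite (negPf hbp).
Qed.

Lemma path_edges_closing a b s : uniq (a :: rcons s b) -> s != [::] ->
  [set a; b] \notin path_edges (a :: rcons s b).
Proof.
case: s => // c s /= /andP[]; rewrite in_cons mem_rcons in_cons !negb_or.
case/and3P=> ac ab as_ /andP[cs Us] _; rewrite path_edgesE in_setU1 negb_or eq_set2 eqxx /=.
rewrite (negPf ac) /= orbF; apply/andP; split.
  by apply: contraNneq cs => <-; rewrite mem_rcons mem_head.
apply/negP => /path_edges_mem/(_ (set21 a b)).
by rewrite in_cons mem_rcons in_cons (negPf ac) (negPf ab) (negPf as_).
Qed.

(** The edge [pq] is the first one outside [F]. It becomes the closing edge whose insertion is
    charged when a short cycle runs partly through [F]. *)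
Lemma path_edges_exit s F : ~~ (path_edges s \subset F) ->
  exists s1 (p q : 'I_n) s2, [/\ s = s1 ++ [:: p, q & s2],
    path_edges (rcons s1 p) \subset F & [set p; q] \notin F].
Proof.
elim: s => [|a [|b s] IH]; rewrite path_edgesE ?sub0set // subUset sub1set.
rewrite negb_and; case: (boolP (_ \in F)) => [abF /IH|abF _]; last first.
  by exists [::], a, b, s; split; rewrite // path_edgesE sub0set.
case=> s1 [p [q [s2 [E H1 H2]]]]; exists (a :: s1), p, q, s2; split=> //.
  by rewrite E.
case: s1 E H1 => [|c s1] [<-] _; first by rewrite path_edgesE subUset sub1set abF => ->.
by move=> H; rewrite /= path_edgesE subUset sub1set abF.
Qed.

(** The return point [x] is kept apart from the head [y], so that the induction can remove the head
    while the path still closes at [x]; a cycle is the case [x = y]. *)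
Lemma next_at_edges x y p : uniq (y :: p) ->
  [set [set v; next_at v x y p] | v in y :: p] = [set last y p; x] |: path_edges (y :: p).
Proof.
elim: p y => [|z p IH] y U.
  apply/setP => f; rewrite path_edgesE setU0 inE; apply/imsetP/eqP => [[v]|->].
    by rewrite inE => /eqP -> ->; rewrite /= eqxx.
  by exists y; rewrite ?mem_head //= eqxx.
have /andP[yzp Uz] : (y \notin z :: p) && uniq (z :: p) by [].
rewrite path_edgesE setUCA -(IH z Uz).
apply/setP => f; rewrite in_setU1; apply/imsetP/orP => [[v]|].
  rewrite in_cons => /orP[/eqP->|vz] ->; first by left; rewrite /= eqxx.
  right; apply/imsetP; exists v => //=; case: eqP vz => // -> vz.
  by rewrite vz in yzp.
case=> [/eqP->|/imsetP[v vz ->]]; first by exists y; rewrite ?mem_head //= eqxx.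
exists v; first by rewrite in_cons vz orbT.
by rewrite /=; case: eqP vz => // -> vz; rewrite vz in yzp.
Qed.

Lemma cycle_edges_cons h p : uniq (h :: p) ->
  cycle_edges (h :: p) = [set last h p; h] |: path_edges (h :: p).
Proof. exact: next_at_edges. Qed.

Lemma cycle_edges_rcons h a p : uniq (h :: rcons p a) ->
  cycle_edges (h :: rcons p a) = [set a; h] |: path_edges (h :: rcons p a).
Proof. by move=> U; rewrite cycle_edges_cons // last_rcons. Qed.

Lemma cycle_edges_rot i s : uniq s -> cycle_edges (rot i s) = cycle_edges s.
Proof.
move=> U; apply/setP => f; apply/imsetP/imsetP => -[v]; rewrite ?mem_rot => vs ->.
  by exists v; rewrite // (next_rot i U).
by exists v; rewrite ?mem_rot // (next_rot i U).
Qed.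

Lemma cycle_edges_rev s : uniq s -> cycle_edges (rev s) = cycle_edges s.
Proof.
case: s => // h p; case/lastP: p => // p a U.
rewrite cycle_edges_rcons // rev_cons rev_rcons rcons_cons.
rewrite cycle_edges_rcons; last by rewrite -rcons_cons -rev_rcons -rev_cons rev_uniq.
congr (_ |: _); first by rewrite setUC.
by rewrite -rcons_cons -rev_rcons -rev_cons path_edges_rev.
Qed.

(** Any edge can be made the closing one: rotate until its first endpoint [v] is last and [next s v]
    is first, and reverse the list if the other orientation is wanted. *)
Lemma cycle_open_at s a b : uniq s -> (3 <= size s)%N -> [set a; b] \in cycle_edges s ->
  exists p, [/\ uniq (b :: rcons p a), size (b :: rcons p a) = size s, p != [::] &
    cycle_edges s = [set a; b] |: path_edges (b :: rcons p a)].
Proof.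
move=> Us s3 /imsetP[v vs /eqP]; rewrite eq_set2.
have [i s' Es] := rot_to vs.
have [w [s'' E']] : exists w s'', s' = w :: s''.
  case: s' Es => [E|w s'' _]; last by exists w, s''.
  by move: s3; rewrite -(size_rot i s) E.
subst s'.
have Ur : uniq [:: v, w & s''] by rewrite -Es rot_uniq.
have Sr : size [:: v, w & s''] = size s by rewrite -Es size_rot.
have s''0 : s'' != [::] by move: s3; rewrite -Sr; case: (s'').
have -> : next s v = w by rewrite -(next_rot i Us) Es /= eqxx.
rewrite -(cycle_edges_rot i Us) Es -(cycle_edges_rot 1 Ur) rot1_cons -Sr.
have U1 : uniq (w :: rcons s'' v) by rewrite -rcons_cons -rot1_cons rot_uniq.
case/orP=> /andP[/eqP-> /eqP->].
  exists s''; split=> //; first by rewrite /= size_rcons.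
  exact: cycle_edges_rcons.
rewrite -cycle_edges_rev // rev_rcons rev_cons.
have U2 : uniq (v :: rcons (rev s'') w) by rewrite -rev_cons -rev_rcons rev_uniq.
exists (rev s''); split=> //; first by rewrite /= size_rcons size_rev.
  by rewrite -size_eq0 size_rev size_eq0.
exact: cycle_edges_rcons.
Qed.

Lemma degree_cycle_edges s v : uniq s -> (3 <= size s)%N ->
  degree (cycle_edges s) v = (2 * (v \in s))%N.
Proof.
case: s => // h p U s3; have : p != [::] by case: (p) s3.
case/lastP: p U s3 => // p a U s3 _.
have p0 : p != [::] by move: s3; rewrite /= size_rcons; case: (p).
rewrite cycle_edges_rcons // setUC -[_ :|: _]setUC.
rewrite degree_edge; last first.
- by rewrite setUC path_edges_closing.
- by apply: contraTneq U => ->; rewrite /= mem_rcons mem_head.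
rewrite degree_path_edges // belast_rcons !(in_cons, mem_rcons).
move: U => /=; rewrite mem_rcons in_cons negb_or rcons_uniq => /andP[/andP[ha hp] /andP[ap _]].
have [->|va] := eqVneq v a; first by rewrite eq_sym (negPf ha) (negPf ap).
have [->|vh] := eqVneq v h; first by rewrite (negPf hp).
by rewrite /= add0n mul2n -addnn.
Qed.

Lemma simple_cycle_edges s : uniq s -> (3 <= size s)%N -> simple_graph (cycle_edges s).
Proof.
move=> U s3; apply/forall_inP => f fs; case/imsetP: (fs) => v vs Ef.
have [|p [Up _ _ _]] := cycle_open_at (a := v) (b := next s v) U s3; first by rewrite -Ef.
by rewrite Ef cards2; case: (v =P next s v) Up => [<-|//]; rewrite /= mem_rcons mem_head.
Qed.

(** Handshake: all vertices of [s] have degree 2, all others degree 0. *)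
Lemma card_cycle_edges s : uniq s -> (3 <= size s)%N -> #|cycle_edges s| = size s.
Proof.
move=> U s3; have := sum_degree (simple_cycle_edges U s3);
  under eq_bigr => v _ do rewrite degree_cycle_edges //.
rewrite -big_distrr /= => /eqP; rewrite eqn_pmul2l // => /eqP <-.
rewrite -(card_uniqP U) -sum1_card [RHS]big_mkcond /=.
by apply: eq_bigr => v _; case: (v \in s).
Qed.

Lemma degree_sub F G v : F \subset G -> (degree F v <= degree G v)%N.
Proof.
move=> FG; apply: subset_leq_card; apply/subsetP => f.
by rewrite !inE => /andP[/(subsetP FG)-> ->].
Qed.

(* At each vertex of the smaller cycle both cycles have the same two edges, so
   its vertex set is closed under [next] in the larger one. *)
Lemma cycle_sub_eq s t : uniq s -> uniq t -> (3 <= size s)%N -> (3 <= size t)%N ->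
  cycle_edges s \subset cycle_edges t -> cycle_edges s = cycle_edges t.
Proof.
move=> Us Ut s3 t3 st.
have st_mem v : v \in s -> v \in t.
  move=> vs; have := degree_sub v st; rewrite !degree_cycle_edges // vs.
  by case: (v \in t).
have cl v : v \in s -> [set v; next t v] \in cycle_edges s.
  move=> vs; have vt := st_mem v vs.
  have /setP/(_ [set v; next t v]) : [set f in cycle_edges s | v \in f] = [set f in
    cycle_edges t | v \in f].
    apply/eqP; rewrite eqEcard; apply/andP; split.
      by apply/subsetP => f; rewrite !inE => /andP[/(subsetP st)-> ->].
    have := degree_cycle_edges v Us s3; have := degree_cycle_edges v Ut t3.
    by rewrite /degree vs vt => -> ->.
  by rewrite !inE eqxx !andbT => ->; apply/imsetP; exists v.
have cl2 v : v \in s -> next t v \in s.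
  move=> /cl H; have := degree_cycle_edges (next t v) Us s3.
  rewrite degreeE (bigD1 _ H) /= set22.
  by case: (_ \in s).
have [v vs] : exists v, v \in s by case: (s) s3 => // v s' _; exists v; rewrite mem_head.
apply/eqP; rewrite eqEsubset st /=; apply/subsetP => f /imsetP[w wt ->].
suff ws : w \in s by apply: cl.
have ht : fconnect (next t) v w.
  have := fconnect_cycle (cycle_next Ut) (st_mem v vs) => /(_ w).
  by rewrite wt.
elim: (iter_findex ht) => {ht}.
by elim: (findex _ _ _) => //= k IH; apply: cl2.
Qed.

End PathEdges.

Arguments path_edges {n} s : simpl never.

(** * Counting paths that close up *)

Section ExtensionSums.
Variables (R : numDomainType) (V : finType).
Implicit Types (s t : seq V) (f g : seq V -> R).

(* The sum of [f (t ++ s)] over all [t] of size [m]: paths grow at the head. *)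
Fixpoint ext_sum m f s : R :=
  if m is m'.+1 then \sum_h ext_sum m' f (h :: s) else f s.

Lemma ext_sum_le m f g s : (forall t, size t = (m + size s)%N -> f t <= g t) ->
  ext_sum m f s <= ext_sum m g s.
Proof.
elim: m s => [|m IH] s fg /=; first exact: fg.
by apply: ler_sum => h _; apply: IH => t; rewrite /= addnS => /fg.
Qed.

Lemma ext_sum_sum (I : finType) (P : pred I) m (f : I -> seq V -> R) s :
  \sum_(i | P i) ext_sum m (f i) s = ext_sum m (fun t => \sum_(i | P i) f i t) s.
Proof.
by elim: m s => [|m IH] s //=; rewrite exchange_big; apply: eq_bigr => h _ /=; rewrite IH.
Qed.

Lemma ext_sumZ m f s c : ext_sum m (fun t => c * f t) s = c * ext_sum m f s.
Proof.
by elim: m s => [|m IH] s //=; rewrite mulr_sumr; apply: eq_bigr => h _.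
Qed.

Lemma ext_sum_ge0 m f s : (forall t, 0 <= f t) -> 0 <= ext_sum m f s.
Proof. by move=> f0; elim: m s => //= m IH s; apply: sumr_ge0. Qed.

Lemma ext_sum_term t f s : (forall t, 0 <= f t) -> f (t ++ s) <= ext_sum (size t) f s.
Proof.
move=> f0; elim/last_ind: t s => [|t h IH] s //=.
rewrite size_rcons /= (bigD1 h) //= cat_rcons (le_trans (IH (h :: s))) // lerDl.
by apply: sumr_ge0 => v _; apply: ext_sum_ge0.
Qed.

End ExtensionSums.

Section PathCounting.
Variables (R : realFieldType) (n d : nat).
Implicit Types (a b c u v w x y h : 'I_n) (F G : edge_set n) (s t : seq 'I_n).
Local Notation reg := (regular_graphs n d).
Local Notation graph_count := (graph_count R d).

Definition path_in G s := uniq s && (path_edges s \subset G).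

Lemma path_in_cons G h s : path_in G (h :: s) -> path_in G s.
Proof.
rewrite /path_in; case/andP=> /= /andP[_ ->] /=; case: s => [|b s];
  first by rewrite path_edges0 sub0set.
by rewrite path_edgesE subUset => /andP[].
Qed.

(** The head has at most [k.+1] neighbours, and one of them, its successor [c] on the path, is
    already used. This is the source of $d-1$, and the reason why paths start with two vertices. *)
Lemma sum_path_in G k s : simple_graph G -> (forall v, degree G v <= k.+1)%N ->
  (2 <= size s)%N -> (\sum_h path_in G (h :: s) <= k * path_in G s)%N.
Proof.
move=> sG dG; case: s => // b [|c s] // _.
case: (boolP (path_in G [:: b, c & s])) => [pG|npG]; last first.
  by rewrite muln0 big1 // => h _; case: (boolP (path_in _ _)) => // /path_in_cons;
    rewrite (negPf npG).
have bcG : [set b; c] \in G by case/andP: pG => _;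
  rewrite path_edgesE subUset sub1set => /andP[].
rewrite muln1 -ltnS; apply: leq_trans (dG b); rewrite -(sum_neighbours b sG).
rewrite (bigD1 c) //= [leqRHS](bigD1 c) //= bcG.
have -> : path_in G [:: c, b, c & s] = false.
  by apply/negbTE; rewrite /path_in /= !inE eqxx orbT.
rewrite add0n add1n ltnS; apply: leq_sum => h _.
case: (boolP (path_in _ _)) => // /andP[_].
by rewrite path_edges_cons2 subUset sub1set setUC => /andP[-> _].
Qed.

Lemma ext_sum_path_in G k m s : simple_graph G -> (forall v, degree G v <= k.+1)%N ->
  (2 <= size s)%N ->
  ext_sum m (fun t => (path_in G t)%:R) s <= k%:R ^+ m * (path_in G s)%:R :> R.
Proof.
move=> sG dG; elim: m s => [|m IH] s s2 /=; first by rewrite expr0 mul1r.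
apply: (@le_trans _ _ (\sum_h k%:R ^+ m * (path_in G (h :: s))%:R)).
  by apply: ler_sum => h _; apply: IH; rewrite /= ltnW.
rewrite -mulr_sumr exprSr -mulrA ler_wpM2l ?exprn_ge0 //.
by rewrite -natr_sum -natrM ler_nat sum_path_in.
Qed.

Lemma sum_subset F (E : edge_set n) :
  \sum_(G in reg | F \subset G) (E \subset G)%:R = graph_count (E :|: F).
Proof.
rewrite /graph_count /graph_sum big_mkcondr [RHS]big_mkcondr /=.
apply: eq_bigr => G _; rewrite subUset.
by case: (F \subset G); rewrite ?andbF ?andbT //; case: (E \subset G).
Qed.

(** The closing edge from the head of [t] to [v] must be new with respect to both [F] and the path,
    so that [edge_insertion_crude] charges $2d/n$ for it. *)
Definition closed_path G F v t :=
  [&& path_in G t, [set head v t; v] \in G, [set head v t; v] \notin F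
    & [set head v t; v] \notin path_edges t].

(** For each fixed [t] the closing edge costs a factor $2d/n$. Once it is dropped, only the paths
    extending [s] by [m] vertices remain, at most $(d-1)^m$ in each graph. *)
Lemma closed_path_count F v m s : (0 < d)%N -> (0 < n)%N -> (2 <= size s)%N ->
  (4 * (#|F| + (m + size s)) + 8 * d + 4 * d ^ 2 <= n * d)%N ->
  \sum_(G in reg | F \subset G) ext_sum m (fun t => (closed_path G F v t)%:R) s <=
  2 * d%:R / n%:R * d.-1%:R ^+ m * graph_count (path_edges s :|: F).
Proof.
move=> d0 n0 s2 K; rewrite ext_sum_sum.
have c0 : 0 <= 2 * d%:R / n%:R :> R by rewrite divr_ge0 ?mulr_ge0.
apply: (@le_trans _ _ (ext_sum m (fun t => 2 * d%:R / n%:R *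
    (\sum_(G in reg | F \subset G) (path_in G t)%:R)) s)).
  apply: ext_sum_le => t st; set cl := [set head v t; v].
  have [ok|nok] := boolP [&& uniq t, cl \notin F & cl \notin path_edges t]; last first.
    rewrite big1; first by apply: mulr_ge0 => //; apply: sumr_ge0.
    move=> G _; rewrite /closed_path /path_in -/cl.
    case: (boolP (_ && _)) => // /and4P[/andP[Ut _] _ H1 H2].
    by move: nok; rewrite Ut H1 H2.
  case/and3P: ok => Ut clF clt.
  rewrite (eq_bigr (fun G => (cl |: path_edges t \subset G)%:R)); last first.
    move=> G _; rewrite /closed_path /path_in -/cl Ut clF clt !andbT /=.
    by rewrite subUset sub1set andbC.
  rewrite [X in _ <= _ * X](eq_bigr (fun G => (path_edges t \subset G)%:R)); last first.
    by move=> G _; rewrite /path_in Ut.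
  rewrite !sum_subset -setUA; apply: edge_insertion_crude => //.
    by rewrite in_setU negb_or clt clF.
  apply: leq_trans K; have := card_path_edges t; rewrite st => ct.
  rewrite !leq_add2r leq_pmul2l //; apply: leq_trans (leq_card_setU _ _).1 _.
  by rewrite addnC leq_add2l (leq_trans ct) // leq_pred.
rewrite ext_sumZ -[leRHS]mulrA ler_wpM2l // -ext_sum_sum -sum_subset mulr_sumr.
apply: ler_sum => G /andP[rG _].
have dG u : (degree G u <= d.-1.+1)%N.
  by rewrite prednK //; move: rG; rewrite inE => /andP[_ /forallP/(_ u)/eqP ->].
apply: le_trans (ext_sum_path_in m (regular_simple rG) dG s2) _.
by rewrite ler_wpM2l ?exprn_ge0 // ler_nat_bool // => /andP[].
Qed.

End PathCounting.

(** With ratio at least 2 the last term dominates; the factor [q] on the left avoids the exponent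
    $k-1$. *)
Lemma geometric_sum_le (R : realFieldType) (q : R) k : 2 <= q ->
  q * \sum_(m < k) q ^+ m <= 2 * q ^+ k.
Proof.
move=> q2; elim: k => [|k IH]; first by rewrite big_ord0 mulr0 mulr_ge0.
rewrite big_ord_recr /= mulrDr -exprS.
have : 2 * q ^+ k <= q ^+ k.+1 by rewrite exprS ler_wpM2r // exprn_ge0; lra.
lra.
Qed.

Lemma geometric_double_sum_le (R : realFieldType) (q : R) k : 2 <= q ->
  q * \sum_(i < k) \sum_(m < k - i) q ^+ m <= 4 * q ^+ k.
Proof.
move=> q2; elim: k => [|k IH]; first by rewrite big_ord0 mulr0 mulr_ge0.
rewrite big_ord_recl /= subn0 mulrDr.
have : q * (\sum_(i < k) \sum_(m < k.+1 - bump 0 i) q ^+ m) <= 4 * q ^+ k by [].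
have := geometric_sum_le k.+1 q2.
have : 2 * q ^+ k <= q ^+ k.+1 by rewrite exprS ler_wpM2r // exprn_ge0; lra.
lra.
Qed.

Lemma ler_sum_term (R : numDomainType) (I : finType) (F : I -> R) (i : I) :
  (forall j, 0 <= F j) -> F i <= \sum_j F j.
Proof. by move=> F0; rewrite (bigD1 i) //= lerDl sumr_ge0. Qed.

(** * Short cycles through an edge outside, or inside, the fixed edge set *)

Section ShortCycles.
Variables (R : realFieldType) (n d r : nat) (cI : {set edge_set n}).
Hypothesis cI_cycle : forall E : edge_set n, E \in cI -> is_cycle E /\ (cycle_length E <= r)%N.
Hypothesis d_gt0 : (0 < d)%N.
Hypothesis n_gt0 : (0 < n)%N.
Implicit Types (a b c u v w x y z h : 'I_n) (F G E : edge_set n) (s t : seq 'I_n).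
Local Notation reg := (regular_graphs n d).
Local Notation graph_count := (graph_count R d).

Definition in_short_cycle G (f : {set 'I_n}) :=
  [exists E in cI, (f \in E) && (E \subset G)].

Lemma sum_graph_count_edge F a :
  \sum_z graph_count ([set z; a] |: F) = d%:R * graph_count F.
Proof.
rewrite (eq_bigr (fun z =>
  \sum_(G in reg | F \subset G) ([set [set z; a]] \subset G)%:R)); last first.
  by move=> z _; rewrite sum_subset.
rewrite exchange_big /= mulr_sumr; apply: eq_bigr => G /andP[rG _].
rewrite mulr1 -(regular_neighboursR R a rG); apply: eq_bigr => z _.
by rewrite sub1set setUC.
Qed.

(** Open the cycle at [ab]: the path from [b] back to [a] ends with [z], [a], and [t] holds the
    other vertices, two fewer than the cycle has, hence at most $r-2$. *)
Lemma short_cycle_closed_path G F a b : [set a; b] \notin F ->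
  in_short_cycle G [set a; b] ->
  exists t z, (size t < r.-1)%N /\
    closed_path G F a (t ++ [:: z; a]) && (head a (t ++ [:: z; a]) == b).
Proof.
move=> abF /existsP[E /and3P[EI abE EG]].
have [[s [Us s3 Es]] sr] := cI_cycle EI.
move: abE sr; rewrite /cycle_length Es => abE; rewrite card_cycle_edges // => sr.
have [p [Up Sp p0 Ep]] := cycle_open_at Us s3 abE.
case/lastP: p p0 Up Sp Ep => // p z _ Up Sp Ep.
exists (b :: p), z; rewrite /= eqxx andbT; split=> //.
  by move: Sp sr; rewrite /= !size_rcons; clear; lia.
have -> : b :: p ++ [:: z; a] = b :: rcons (rcons p z) a by rewrite -!cats1 -catA.
move: EG; rewrite Es Ep subUset sub1set => /andP[abG pG].
rewrite /closed_path /path_in Up pG /= [[set b; a]]setUC abG abF /=.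
rewrite setUC; apply: path_edges_closing => //.
by case: (p).
Qed.

(** The factors are [d] for the neighbour [z] of [a], $(d-1)^m$ for the rest of the path and $2d/n$
    for the closing edge. *)
Lemma short_cycle_count F a : (4 * (#|F| + r) + 8 * d + 4 * d ^ 2 <= n * d)%N ->
  \sum_(G in reg | F \subset G)
     \sum_b (([set a; b] \notin F) && in_short_cycle G [set a; b])%:R <=
  2 * d%:R / n%:R * d%:R * (\sum_(m < r.-1) d.-1%:R ^+ m) * graph_count F.
Proof.
move=> K.
apply: (@le_trans _ _ (\sum_(m < r.-1) \sum_z \sum_(G in reg | F \subset G)
    ext_sum m (fun t => (closed_path G F a t)%:R) [:: z; a])).
  under [leRHS]eq_bigr => m _ do rewrite exchange_big /=.
  rewrite [leRHS]exchange_big /=; apply: ler_sum => G _.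
  apply: (@le_trans _ _ (\sum_b \sum_(m < r.-1) \sum_z
      ext_sum m (fun t => (closed_path G F a t && (head a t == b))%:R) [:: z; a])).
    apply: ler_sum => b _.
    have tot0 (m : 'I_r.-1) z : 0 <= ext_sum m (fun t => (closed_path G F a t && (head a t ==
      b))%:R) [:: z; a] :> R.
      by apply: ext_sum_ge0.
    case: (boolP (_ && _)) => [|_]; last by apply: sumr_ge0 => m _; apply: sumr_ge0.
    case/andP=> abF /(short_cycle_closed_path abF)[t [z [st H]]].
    apply: le_trans (ler_sum_term (Ordinal st) _) => [|m]; last by apply: sumr_ge0.
    apply: le_trans (ler_sum_term z _) => [|w]; last exact: tot0.
    apply: le_trans (ext_sum_term t [:: z; a] _) => //=.
    by rewrite H.
  rewrite exchange_big /=; apply: ler_sum => m _.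
  rewrite exchange_big /=; apply: ler_sum => z _.
  (* Since [b] must be the head of [t], the sum over [b] counts each path once and costs no factor
     [n]. *)
  rewrite ext_sum_sum; apply: ext_sum_le => t _.
  case: (closed_path G F a t) => /=; last by rewrite big1.
  by rewrite (bigD1 (head a t)) //= eqxx big1 ?addr0 // => b; rewrite eq_sym => /negPf ->.
have -> : 2 * d%:R / n%:R * d%:R * (\sum_(m < r.-1) d.-1%:R ^+ m) * graph_count F =
    \sum_(m < r.-1) 2 * d%:R / n%:R * d.-1%:R ^+ m * (d%:R * graph_count F).
  by rewrite -mulr_suml -mulr_sumr; ring.
apply: ler_sum => m _.
apply: (@le_trans _ _ (\sum_z 2 * d%:R / n%:R * d.-1%:R ^+ m * graph_count ([set z; a] |: F))).
  apply: ler_sum => z _; apply: le_trans (closed_path_count R a d_gt0 n_gt0 _ _) _ => //.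
    apply: leq_trans K; have := ltn_ord m; rewrite /=; clear.
    by move: (nat_of_ord m) => k; lia.
  by rewrite path_edgesE path_edges1 setU0.
by rewrite -mulr_sumr sum_graph_count_edge.
Qed.

(* Following the cycle from [x] away from [y], the part inside [F] is forced
   because [F] has maximum degree 2, and the first edge outside [F] is the
   closing edge of a path starting with [x], [y]. *)
Lemma short_cycle_through_count F x y (A : edge_set n) :
    simple_graph F -> (forall v, degree F v <= 2)%N -> [set x; y] \in F ->
    (forall E, E \in cI -> E != A -> ~~ (E \subset F)) ->
    (4 * (#|F| + r) + 8 * d + 4 * d ^ 2 <= n * d)%N ->
  \sum_(G in reg | F \subset G)
     [exists E in cI, [&& E != A, [set x; y] \in E & E \subset G]]%:R <=
  2 * d%:R / n%:R * (\sum_(i < r.-1) \sum_(m < r.-1 - i) d.-1%:R ^+ m) * graph_count F.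
Proof.
move=> sF dF xyF nF K.
apply: (@le_trans _ _ (\sum_(G in reg | F \subset G) \sum_(i < r.-1) \sum_(m < r.-1 - i)
   ext_sum i (fun t => (path_in F t)%:R *
     ext_sum m (fun t' => (closed_path G F (head x t) t')%:R) [:: y; x]) [:: x; y])).
  apply: ler_sum => G /andP[rG FG].
  have tot0 (i m : nat) : 0 <= ext_sum i (fun t => (path_in F t)%:R *
     ext_sum m (fun t' => (closed_path G F (head x t) t')%:R) [:: y; x]) [:: x; y] :> R.
    by apply: ext_sum_ge0 => t; apply: mulr_ge0 => //; apply: ext_sum_ge0.
  case: (boolP [exists E in cI, _]) => [|_]; last first.
    by apply: sumr_ge0 => i _; apply: sumr_ge0.
  case/existsP=> E /and4P[EI EA xyE EG].
  have [[s [Us s3 Es]] sr] := cI_cycle EI.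
  have EF := nF E EI EA.
  move: xyE sr EF EG; rewrite /cycle_length Es => xyE.
  rewrite card_cycle_edges // => sr EF EG.
  have yxE : [set y; x] \in cycle_edges s by rewrite setUC.
  have [p [Up Sp p0 Ep]] := cycle_open_at Us s3 yxE.
  (* The cycle is not inside [F] while [xy] is, so the rest of the cycle, a path from [x] to [y],
     leaves [F] at some first edge [uv]. *)
  have {EF} : ~~ (path_edges (x :: rcons p y) \subset F).
    by move: EF; rewrite Ep subUset sub1set setUC xyF.
  case/path_edges_exit=> s1 [u [v [s2 [EL s1F uvF]]]].
  have [s1' E1] : exists s1', rcons s1 u = x :: s1'.
    by case: (s1) EL => [|a s1'] [-> _]; [exists [::]|exists (rcons s1' u)].
  have [s2' E2] : exists s2', v :: s2 = rcons s2' y.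
    exists (belast v s2); rewrite lastI; congr rcons.
    by have := congr1 (last x) EL; rewrite /= last_rcons last_cat /=.
  have EL' : x :: rcons p y = x :: (s1' ++ rcons s2' y).
    by rewrite EL -cat_cons -E1 -E2 cat_rcons.
  have SL : (size s1' + size s2' + 2 = size s)%N.
    by rewrite -Sp EL' /= size_cat size_rcons; clear; lia.
  have i_lt : (size s1' < r.-1)%N by clear -SL sr; lia.
  have m_lt : (size s2' < r.-1 - size s1')%N by clear -SL sr; lia.
  have pG : path_edges (x :: rcons p y) \subset G.
    by move: EG; rewrite Ep subUset => /andP[].
  have yxG : [set y; x] \in G by apply: (subsetP EG).
  apply: le_trans (ler_sum_term (Ordinal i_lt) _) => [|i]; last by apply: sumr_ge0.
  apply: le_trans (ler_sum_term (Ordinal m_lt) _) => [|m] /=; last exact: tot0.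
  rewrite -(size_rev s1').
  apply: le_trans (ext_sum_term (rev s1') [:: x; y] _) => /=; last first.
    by move=> t; apply: mulr_ge0 => //; apply: ext_sum_ge0.
  have U' : uniq (x :: s1' ++ rcons s2' y) by rewrite -EL'.
  have -> : path_in F (rev s1' ++ [:: x; y]).
    have -> : rev s1' ++ [:: x; y] = rev [:: y, x & s1'] by rewrite !rev_cons -!cats1 -catA.
    rewrite /path_in rev_uniq path_edges_rev path_edgesE subUset sub1set setUC xyF.
    rewrite -E1 s1F andbT E1 cons_uniq.
    move: U'; rewrite -cat_cons cat_uniq => /and3P[-> /hasPn/(_ y) H _].
    by rewrite H ?mem_rcons ?mem_head.
  have -> : head x (rev s1' ++ [:: x; y]) = u.
    have -> : rev s1' ++ [:: x; y] = rcons (rev (x :: s1')) y by rewrite rev_cons -!cats1 -catA.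
    by rewrite -E1 rev_rcons.
  rewrite mul1r; apply: le_trans (ext_sum_term s2' [:: y; x] _) => //.
  rewrite ler1n lt0b /closed_path.
  have Et : s2' ++ [:: y; x] = rcons (v :: s2) x by rewrite E2 -!cats1 -catA.
  have Eh : head u (s2' ++ [:: y; x]) = v by rewrite Et.
  rewrite Eh [[set v; u]]setUC uvF.
  have xt : x \notin s1' ++ rcons s2' y by move: U' => /= /andP[].
  have -> : path_in G (s2' ++ [:: y; x]).
    rewrite /path_in Et rcons_uniq; apply/andP; split.
      move: U'; rewrite -E2 /= mem_cat negb_or => /andP[/andP[_ ->]].
      by rewrite cat_uniq => /and3P[].
    rewrite E2 path_edges_rcons subUset sub1set yxG -E2 /=.
    by move: pG; rewrite EL path_edges_cat subUset path_edgesE subUset => /andP[_ /andP[]].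
  have -> /= : [set u; v] \in G.
    by move: pG; rewrite EL path_edges_cat subUset path_edgesE subUset sub1set => /andP[_
      /andP[]].
  (* If [uv] were an edge of the second path, [u] would lie on both stretches of the cycle, so
     [u = x]; the only edge of that path at [x] is [yx], which lies in [F], unlike [uv]. *)
  apply/negP => uvt; rewrite Et in uvt.
  have us : u \in x :: s1' by rewrite -E1 mem_rcons mem_head.
  have ut : u \in rcons (v :: s2) x by apply: path_edges_mem uvt (set21 u v).
  have Eu : u = x.
    apply/eqP; move: ut; rewrite mem_rcons in_cons => /orP[//|ut].
    move: U'; rewrite -E2 -cat_cons cat_uniq => /and3P[_ /hasPn/(_ u ut)].
    by rewrite us.
  move: uvt uvF; rewrite Eu E2 path_edges_rcons in_setU1 eq_set2 => /orP[|].
    case/orP=> /andP[/eqP E3 /eqP E4].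
      by move: xt; rewrite mem_cat mem_rcons -E3 mem_head orbT.
    by rewrite E4 xyF.
  move/path_edges_mem=> /(_ x (set21 x v)) xs2.
  by move: xt; rewrite mem_cat xs2 orbT.
rewrite [X in _ <= X * _]mulr_sumr mulr_suml exchange_big /=; apply: ler_sum => i _.
rewrite [X in _ <= X * _]mulr_sumr mulr_suml exchange_big /=; apply: ler_sum => m _.
rewrite ext_sum_sum.
(* The second path is counted first, uniformly in the point [head x t] where it closes. What remains
   is the number of paths inside [F], at most $1^i$. *)
apply: (@le_trans _ _ (ext_sum i (fun t => (2 * d%:R / n%:R * d.-1%:R ^+ m * graph_count F) *
  (path_in F t)%:R) [:: x; y])).
  apply: ext_sum_le => t _; rewrite -mulr_sumr mulrC.
  apply: ler_wpM2r => //; apply: le_trans (closed_path_count R _ d_gt0 n_gt0 _ _) _ => //.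
    apply: leq_trans K; have := ltn_ord m; rewrite /=; clear.
    by case: m => /= m _; move: (nat_of_ord i) => j; lia.
  rewrite !path_edgesE setU0 (setUidPr _) // sub1set setUC //.
rewrite ext_sumZ [leRHS](_ : _ = 2 * d%:R / n%:R * d.-1%:R ^+ m * graph_count F * 1);
  last by ring.
apply: ler_wpM2l.
  by rewrite !mulr_ge0 ?exprn_ge0 ?graph_count_ge0 ?invr_ge0.
apply: le_trans (ext_sum_path_in R i sF dF _) _ => //.
by rewrite expr1n mul1r lern1 leq_b1.
Qed.

End ShortCycles.

(** * The effect of a switching on short cycles *)

Section SwitchingStep.
Variables (R : realFieldType) (n d r : nat) (cI : {set edge_set n}).
Hypothesis cI_cycle : forall E : edge_set n, E \in cI -> is_cycle E /\ (cycle_length E <= r)%N.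
Hypothesis d_gt0 : (0 < d)%N.
Hypothesis n_gt0 : (0 < n)%N.
Hypothesis r_ge3 : (3 <= r)%N.
Hypothesis size_nd : (4 * (2 * r) + 8 * d + 4 * d ^ 2 <= n * d)%N.
Variable c : seq 'I_n.
Hypothesis c_uniq : uniq c.
Hypothesis c_ge3 : (3 <= size c)%N.
Hypothesis c_ler : (size c <= r)%N.
Let A : edge_set n := cycle_edges c.
Variables (F : edge_set n) (x y : 'I_n).
Let F0 : edge_set n := [set x; y] |: F.
Hypothesis x_neq_y : x != y.
Hypothesis xy_notin : [set x; y] \notin F.
Hypothesis F0A : F0 \subset A.
Implicit Types (u v w : 'I_n) (G E : edge_set n).
Local Notation reg := (regular_graphs n d).
Local Notation graph_count := (graph_count R d).
Local Notation graph_sum := (@graph_sum R n d).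
Local Notation sw := (switchable d F).

(** [K1] bounds the ordered edges that spoil a deletion of [xy]; [D] is the number of candidate
    pairs for its insertion. *)
Let K1 : R := (2 * #|F| + 4 * d + 2 * d ^ 2)%:R.
Let D : R := (d%:R - (degree F x)%:R) * (d%:R - (degree F y)%:R).

Lemma card_F0 : (#|F0| <= r)%N.
Proof. by apply: leq_trans (subset_leq_card F0A) _; rewrite card_cycle_edges. Qed.

Lemma card_F : (#|F|.+1 <= r)%N.
Proof. by move: card_F0; rewrite cardsU1 xy_notin. Qed.

Lemma F0_sub G : (F0 \subset G) = ([set x; y] \in G) && (F \subset G).
Proof. by rewrite subUset sub1set. Qed.

Lemma insertion_count E (f : {set 'I_n}) : f \notin F -> f \notin E -> (#|E| <= 2)%N ->
  \sum_(G in reg | F \subset G) ((f \in G) && (E \subset G))%:R <=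
  2 * d%:R / n%:R * \sum_(G in reg | F \subset G) (E \subset G)%:R :> R.
Proof.
move=> fF fE E2; rewrite (eq_bigr (fun G => (f |: E \subset G)%:R)); last first.
  by move=> G _; rewrite subUset sub1set.
rewrite !sum_subset -setUA; apply: edge_insertion_crude => //.
  by rewrite in_setU negb_or fE fF.
apply: leq_trans size_nd; rewrite !leq_add2r leq_pmul2l //.
apply: leq_trans (leq_card_setU _ _).1 _; have := card_F; clear -E2 r_ge3.
by move: #|_| E2 #|_| => ? ? ?; lia.
Qed.

Lemma switch_sum_le G : G \in reg -> \sum_u \sum_w (sw x y u w G)%:R <= n%:R * d%:R :> R.
Proof.
move=> rG; have -> : n%:R * d%:R = \sum_(u < n) d%:R :> R.
  by rewrite sumr_const card_ord mulr_natl.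
apply: ler_sum => u _; rewrite -(regular_neighboursR R u rG); apply: ler_sum => w _.
by apply: ler_nat_bool => /switchableP[_ _ _ [_ _ ->]].
Qed.

Lemma forward_count_error h : (forall G, `|h G| <= 1) ->
  `|n%:R * d%:R * graph_sum h F0 -
     \sum_u \sum_w \sum_(G | sw x y u w G) h G| <= K1 * graph_count F0.
Proof.
move=> h1; rewrite (sum_triple _ (@switchable_edge_sub n d F x y)).
rewrite /graph_sum /graph_count mulr_sumr -sumrB mulr_sumr.
apply: le_trans (ler_norm_sum _ _ _) _; apply: ler_sum => G /andP[rG].
rewrite F0_sub => /andP[xyG FG].
rewrite mulrC -mulrBr normrM mulr1 -[leRHS]mul1r; apply: ler_pM => //.
have xyGF : [set x; y] \in G :\: F by rewrite inE xyG xy_notin.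
rewrite ger0_norm ?subr_ge0 ?switch_sum_le // lerBlDl -lerBlDr.
exact: switchable_sum_ge.
Qed.

(** A candidate pair fails if [xy] is present ([T1], which covers [u = y] and [w = x]), if [u = w]
    ([T2]), or if [uw] is an edge ([T3]). In each case an extra edge closes a walk: [xy], [uy] or
    [wy] respectively, at a cost of $2d/n$ against $d^2$, $d$ and $d^2$ choices. *)
Lemma backward_count_error h : (forall G, `|h G| <= 1) ->
  `|D * graph_sum h F - \sum_u \sum_w \sum_(G | sw x u y w G) h G| <=
  2 * d%:R / n%:R * (2 * d%:R ^+ 2 + d%:R) * graph_count F.
Proof.
move=> h1; rewrite (sum_triple _ (fun u w => @switchable_sub n d F x u y w)).
rewrite /graph_sum mulr_sumr -sumrB; apply: le_trans (ler_norm_sum _ _ _) _.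
pose g G u v : R := ([set u; v] \in G)%:R.
pose T1 := \sum_(G in reg | F \subset G) ([set x;
  y] \in G)%:R * \sum_u \sum_w g G x u * g G y w.
pose T2 := \sum_u \sum_(G in reg | F \subset G)
   (([set u; y] \notin F) && (([set u; y] \in G) && ([set [set x; u]] \subset G)))%:R : R.
pose T3 := \sum_u \sum_w \sum_(G in reg | F \subset G)
   ([&& w != x, u != y & [set w; y] \notin F] &&
    (([set w; y] \in G) && ([set [set x; u]; [set u; w]] \subset G)))%:R : R.
have gd G u : G \in reg -> \sum_w g G u w = d%:R by apply: regular_neighboursR.
apply: (@le_trans _ _ (T1 + T2 + T3)).
  rewrite /T2 /T3 exchange_big /=.
  under [X in _ <= _ + X]eq_bigr => u _ do rewrite exchange_big /=.
  rewrite [X in _ <= _ + X]exchange_big /= -!big_split /=.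
  apply: ler_sum => G /andP[rG FG].
  rewrite mulrC -mulrBr normrM -[leRHS]mul1r; apply: ler_pM => //.
  rewrite ger0_norm ?subr_ge0; last exact: switchable_sum_le.
  rewrite lerBlDr /D -!(regular_neighbours_outside R _ rG FG) mulr_suml mulr_sumr.
  rewrite -!big_split /=; apply: ler_sum => u _.
  rewrite !mulr_sumr.
  have -> : ([set u; y] \notin F) && (([set u; y] \in G) && ([set [set x; u]] \subset G)) =
     (\sum_w [&& u == w, [set w; y] \notin F, [set w; y] \in G & [set x; u] \in G])%N :> nat.
    rewrite (bigD1 u) //= eqxx big1 ?addn0; last by move=> w; rewrite eq_sym => /negPf ->.
    by rewrite sub1set.
  rewrite natr_sum -!big_split /=; apply: ler_sum => w _.
  rewrite /g -!natrM -!natrD ler_nat subUset !sub1set.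
  rewrite /switchable rG FG !in_setD [[set w; y]]setUC /= !inE.
  case: (boolP ([set x; u] \in G)) => xuG; rewrite ?andbF //= ?muln0 //.
  case: (boolP ([set y; w] \in G)) => ywG; rewrite ?andbF ?muln0 //=.
  case: (boolP ([set x; u] \in F)) => //= xuF.
  case: (boolP ([set y; w] \in F)) => //= ywF; rewrite ?muln0 //.
  have sG := regular_simple rG.
  rewrite (negPf x_neq_y) (negPf (simple_edge_neq sG xuG)) (simple_edge_neq sG ywG) (eq_sym w
    x).
  case: (boolP ([set x; y] \in G)) => [_ //|xyG] /=.
  have /negPf -> : x != w by apply: contraNneq xyG => ->; rewrite setUC.
  have /negPf -> : u != y by apply: contraNneq xyG => <-.
  by case: (u == w); case: ([set u; w] \in G).
have c0 : 0 <= 2 * d%:R / n%:R :> R by rewrite !mulr_ge0 ?invr_ge0.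
have B1 : T1 <= 2 * d%:R / n%:R * (d%:R ^+ 2 * graph_count F).
  have -> : T1 = d%:R ^+ 2 * graph_count F0.
    rewrite /F0 -sum_subset mulr_sumr; apply: eq_bigr => G /andP[rG _].
    rewrite sub1set mulrC; congr (_ * _).
    under eq_bigr => u _ do rewrite -mulr_sumr gd //.
    by rewrite -mulr_suml gd // expr2.
  rewrite mulrCA ler_wpM2l ?exprn_ge0 //; apply: edge_insertion_crude => //.
  apply: leq_trans size_nd; rewrite !leq_add2r leq_pmul2l //; have := card_F; clear.
  by move: #|_| => ?; lia.
have sum1 : \sum_u \sum_(G in reg | F \subset G) ([set [set x; u]] \subset G)%:R =
    d%:R * graph_count F :> R.
  rewrite exchange_big /= mulr_sumr; apply: eq_bigr => G /andP[rG _].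
  rewrite mulr1 -(gd G x rG); apply: eq_bigr => u _.
  by rewrite sub1set.
have B2 : T2 <= 2 * d%:R / n%:R * (d%:R * graph_count F).
  rewrite -sum1 mulr_sumr; apply: ler_sum => u _.
  have [uyF|uyF] := boolP ([set u; y] \in F).
    by rewrite big1 // mulr_ge0 // sumr_ge0.
  apply: insertion_count => //; last by rewrite cards1.
  rewrite inE eq_set2 [y == x]eq_sym (negPf x_neq_y) andbF orbF.
  by apply/negP => /andP[/eqP-> /eqP E]; move: x_neq_y; rewrite E eqxx.
have B3 : T3 <= 2 * d%:R / n%:R * (d%:R ^+ 2 * graph_count F).
  have -> : d%:R ^+ 2 * graph_count F = \sum_u \sum_w \sum_(G in reg | F \subset G)
      ([set [set x; u]; [set u; w]] \subset G)%:R.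
    rewrite expr2 -mulrA -sum1 mulr_sumr; apply: eq_bigr => u _.
    rewrite exchange_big /= mulr_sumr; apply: eq_bigr => G /andP[rG _].
    rewrite -(gd G u rG) mulr_suml; apply: eq_bigr => w _.
    by rewrite subUset !sub1set /g -natrM mulnb andbC.
  rewrite mulr_sumr; apply: ler_sum => u _; rewrite mulr_sumr; apply: ler_sum => w _.
  case: (boolP [&& w != x, u != y & _]) => [/and3P[wx uy wyF]|_]; last first.
    by rewrite big1 // mulr_ge0 // sumr_ge0.
  apply: insertion_count => //; last by rewrite cards2; case: (_ != _).
  rewrite !inE !eq_set2 (negPf wx) [y == x]eq_sym (negPf x_neq_y) [y == u]eq_sym (negPf uy).
  rewrite !andbF /= orbF; apply/negP => /andP[/eqP wu /eqP yw].
  by move: uy; rewrite yw wu eqxx.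
have : 2 * d%:R / n%:R * (2 * d%:R ^+ 2 + d%:R) * graph_count F =
   2 * d%:R / n%:R * (d%:R ^+ 2 * graph_count F) + 2 * d%:R / n%:R * (d%:R * graph_count F)
   + 2 * d%:R / n%:R * (d%:R ^+ 2 * graph_count F) by ring.
by move=> ->; apply: lerD => //; apply: lerD.
Qed.

(** [A] has to be excluded: [F0] may be all of [A], and then every graph under consideration
    contains it. *)
Definition affected_through G : bool :=
  [exists E in cI, [&& E != A, [set x; y] \in E & E \subset G]].

Lemma switch_affected (h : edge_set n -> R) u w G :
    (forall G, `|h G| <= 1) ->
    (forall G G', (forall E, E \in cI -> E != A -> (E \subset G) = (E \subset G')) -> h G = h
      G') ->
  `|h (switch x u y w G) - h G| <= 2 * ((affected_through (switch x u y w G))%:R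
     + (in_short_cycle cI (switch x u y w G) [set u; w])%:R
     + (in_short_cycle cI G [set x; u])%:R + (in_short_cycle cI G [set y; w])%:R).
Proof.
move=> h1 hdep; set G' := switch _ _ _ _ _.
have [/forallP eqE|] := boolP [forall E, (E \in cI) ==> (E != A) ==> ((E \subset G') == (E
  \subset G))].
  rewrite (hdep G' G) ?subrr ?normr0 ?mulr_ge0 ?addr_ge0 // => E EI EA.
  by move: (eqE E); rewrite EI EA => /eqP.
rewrite negb_forall => /existsP[E]; rewrite !negb_imply => /and3P[EI EA neq].
apply: (@le_trans _ _ 2).
  apply: le_trans (ler_normB _ _) _.
  by rewrite (_ : 2 = 1 + 1) ?lerD //; lra.
rewrite -[leLHS]mulr1 ler_pM2l // -!natrD ler1n.
case: (boolP (E \subset G')) neq => [EG'|nEG']; case: (boolP (E \subset G)) => [EG|nEG] // _.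
- case/subsetPn: nEG => f fE fG; have := subsetP EG' f fE.
  rewrite in_switch (negPf fG) !andbF orbF => /orP[] /eqP Ef; subst f.
    suff -> : affected_through G' by [].
    by apply/existsP; exists E; rewrite EI EA fE EG'.
  suff -> : in_short_cycle cI G' [set u; w] by rewrite addn1 !addSn.
  by apply/existsP; exists E; rewrite EI fE EG'.
- case/subsetPn: nEG' => f fE; rewrite in_switch !negb_or !negb_and !negbK.
  rewrite (subsetP EG f fE) orbF => /and3P[_ _ /orP[] /eqP Ef]; subst f.
    suff -> : in_short_cycle cI G [set y; w] by rewrite addn1.
    by apply/existsP; exists E; rewrite EI fE EG.
  suff -> : in_short_cycle cI G [set x; u] by rewrite addn1 addSn.
  by apply/existsP; exists E; rewrite EI fE EG.
Qed.

(** [m] is the number of free steps of a path before it closes; in [Dg] the additional index [i] is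
    the length of the forced stretch inside [F0]. *)
Let Sg : R := \sum_(m < r.-1) d.-1%:R ^+ m.
Let Dg : R := \sum_(i < r.-1) \sum_(m < r.-1 - i) d.-1%:R ^+ m.

Lemma affected_through_count :
  \sum_(G in reg | F0 \subset G) (affected_through G)%:R <=
  2 * d%:R / n%:R * Dg * graph_count F0.
Proof.
apply: short_cycle_through_count => //.
- exact: simple_sub F0A (simple_cycle_edges c_uniq c_ge3).
- move=> v; apply: leq_trans (degree_sub v F0A) _; rewrite degree_cycle_edges //.
  by case: (v \in c).
- exact: setU11.
- move=> E EI; apply: contra => EF; apply/eqP.
  have [[s [Us s3 Es]] _] := cI_cycle EI; rewrite Es; apply: cycle_sub_eq => //.
  by rewrite -Es; apply: subset_trans F0A.
- apply: leq_trans size_nd; rewrite !leq_add2r leq_pmul2l //; have := card_F0; clear.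
  by move: #|_| => ?; lia.
Qed.

Lemma switching_change (h : edge_set n -> R) :
    (forall G, `|h G| <= 1) ->
    (forall G G', (forall E, E \in cI -> E != A -> (E \subset G) = (E \subset G')) -> h G = h
      G') ->
  `|\sum_u \sum_w \sum_(G | sw x y u w G) h G - \sum_u \sum_w \sum_(G | sw x u y w G) h G| <=
  2 * (2 * d%:R ^+ 2 * Dg * graph_count F0 + 2 * d%:R ^+ 2 * Sg * graph_count F0
    + 2 * (2 * d%:R / n%:R * d%:R ^+ 2 * Sg * graph_count F)).
Proof.
move=> h1 hdep.
have nR : n%:R != 0 :> R by rewrite pnatr_eq0 -lt0n.
pose B1 : R := \sum_u \sum_w \sum_(G | sw x u y w G) (affected_through (switch x u y w G))%:R.
pose B2 : R := \sum_u \sum_w \sum_(G | sw x u y w G) (in_short_cycle cI (switch x u y w G)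
  [set u; w])%:R.
pose B3 : R := \sum_u \sum_w \sum_(G | sw x u y w G) (in_short_cycle cI G [set x; u])%:R.
pose B4 : R := \sum_u \sum_w \sum_(G | sw x u y w G) (in_short_cycle cI G [set y; w])%:R.
have cF0 : (4 * (#|F0| + r) + 8 * d + 4 * d ^ 2 <= n * d)%N.
  apply: leq_trans size_nd; rewrite !leq_add2r leq_pmul2l //; have := card_F0; clear.
  by move: #|_| => ?; lia.
have cF : (4 * (#|F| + r) + 8 * d + 4 * d ^ 2 <= n * d)%N.
  apply: leq_trans size_nd; rewrite !leq_add2r leq_pmul2l //; have := card_F; clear.
  by move: #|_| => ?; lia.
(* The bijection moves this count to graphs containing [xy], with at most [n * d] switches each; the
   [n] cancels against $2d/n$. *)
have H1 : B1 <= 2 * d%:R ^+ 2 * Dg * graph_count F0.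
  rewrite /B1 (eq_bigr (fun u => \sum_w \sum_(G | sw x y u w G) (affected_through G)%:R));
    last first.
    by move=> u _; apply: eq_bigr => w _; rewrite [RHS]sum_switch.
  rewrite (sum_triple _ (@switchable_edge_sub n d F x y)).
  apply: (@le_trans _ _ (\sum_(G in reg | F0 \subset G) (affected_through G)%:R * (n%:R *
    d%:R))).
    by apply: ler_sum => G /andP[rG _]; rewrite ler_wpM2l ?switch_sum_le.
  rewrite -mulr_suml; apply: le_trans (ler_wpM2r _ affected_through_count) _;
    first by rewrite mulr_ge0.
  by rewrite le_eqVlt; apply/orP; left; apply/eqP; field.
(* After the bijection [uw] is an edge outside [F0], so the count at [u] is summed over all [n]
   vertices [u]. *)
have H2 : B2 <= 2 * d%:R ^+ 2 * Sg * graph_count F0.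
  rewrite /B2 (eq_bigr (fun u => \sum_w \sum_(G | sw x y u w G) (in_short_cycle cI G [set u;
    w])%:R)); last first.
    move=> u _; apply: eq_bigr => w _.
    by rewrite (sum_switch d F x y u w (fun G => (in_short_cycle cI G [set u; w])%:R)).
  apply: (@le_trans _ _ (\sum_(u < n) (2 * d%:R / n%:R * d%:R * Sg * graph_count F0)));
    last first.
    rewrite big_const_ord iter_addr addr0 -[leLHS]mulr_natl.
    by rewrite le_eqVlt; apply/orP; left; apply/eqP; field.
  apply: ler_sum => u _; apply: le_trans (short_cycle_count R cI_cycle d_gt0 n_gt0 u cF0).
  rewrite exchange_big /=.
  rewrite (eq_bigr (fun w => \sum_(G in reg | F0 \subset G) (sw x y u w G && in_short_cycle cI
    G [set u; w])%:R)).
    apply: ler_sum => w _; apply: ler_sum => G _.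
    apply: ler_nat_bool => /andP[/switchableP[_ _ U [_ _ _ uwF] _] ->].
    by rewrite andbT in_setU1 negb_or uwF andbT eq_sym; have [] := uniq4_set2 U.
  move=> w _; rewrite big_mkcond [RHS]big_mkcond /=; apply: eq_bigr => G _.
  case: (boolP (sw x y u w G)) => [/switchable_edge_sub -> //|_].
  by case: ifP.
have gd G u : G \in reg -> \sum_w ([set u;
  w] \in G)%:R = d%:R :> R by apply: regular_neighboursR.
(* The [d] neighbours [w] of [y] are free, which leaves the count of short cycles at [x]. The bound
   on [B4] is symmetric. *)
have H3 : B3 <= 2 * d%:R / n%:R * d%:R ^+ 2 * Sg * graph_count F.
  apply: (@le_trans _ _ (d%:R * \sum_(G in reg | F \subset G) \sum_u
     (([set x; u] \notin F) && in_short_cycle cI G [set x; u])%:R)); last first.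
    apply: le_trans (ler_wpM2l _ (short_cycle_count R cI_cycle d_gt0 n_gt0 x cF)) _ => //.
    by rewrite le_eqVlt; apply/orP; left; apply/eqP; rewrite -/Sg; field.
  rewrite mulr_sumr (eq_bigr (fun G => \sum_u d%:R * (([set x;
    u] \notin F) && in_short_cycle cI G [set x; u])%:R)); last first.
    by move=> G _; rewrite mulr_sumr.
  rewrite exchange_big /=; apply: ler_sum => u _.
  rewrite (eq_bigr (fun G => \sum_w ([set y; w] \in G)%:R * (([set x;
    u] \notin F) && in_short_cycle cI G [set x; u])%:R)); last first.
    by move=> G /andP[rG _]; rewrite -mulr_suml gd.
  rewrite exchange_big /=; apply: ler_sum => w _.
  rewrite big_mkcond [leRHS]big_mkcond /=; apply: ler_sum => G _.
  case: (boolP (sw x u y w G)) => [/switchableP[-> -> _ [_ -> -> _] _]|_];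
    first by rewrite mul1r.
  by case: ifP; rewrite ?mulr_ge0.
have H4 : B4 <= 2 * d%:R / n%:R * d%:R ^+ 2 * Sg * graph_count F.
  apply: (@le_trans _ _ (d%:R * \sum_(G in reg | F \subset G) \sum_w
     (([set y; w] \notin F) && in_short_cycle cI G [set y; w])%:R)); last first.
    apply: le_trans (ler_wpM2l _ (short_cycle_count R cI_cycle d_gt0 n_gt0 y cF)) _ => //.
    by rewrite le_eqVlt; apply/orP; left; apply/eqP; rewrite -/Sg; field.
  rewrite mulr_sumr (eq_bigr (fun G => \sum_w d%:R * (([set y;
    w] \notin F) && in_short_cycle cI G [set y; w])%:R)); last first.
    by move=> G _; rewrite mulr_sumr.
  rewrite /B4 exchange_big [leRHS]exchange_big /=; apply: ler_sum => w _.
  rewrite (eq_bigr (fun G => \sum_u ([set x; u] \in G)%:R * (([set y;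
    w] \notin F) && in_short_cycle cI G [set y; w])%:R)); last first.
    by move=> G /andP[rG _]; rewrite -mulr_suml gd.
  rewrite exchange_big /=; apply: ler_sum => u _.
  rewrite big_mkcond [leRHS]big_mkcond /=; apply: ler_sum => G _.
  case: (boolP (sw x u y w G)) => [/switchableP[-> -> _ [-> _ _ ->] _]|_];
    first by rewrite mul1r.
  by case: ifP; rewrite ?mulr_ge0.
apply: (@le_trans _ _ (2 * (B1 + B2 + B3 + B4))); last first.
  by rewrite ler_pM2l //; lra.
rewrite (eq_bigr (fun u => \sum_w \sum_(G | sw x u y w G) h (switch x u y w G))); last first.
  by move=> u _; apply: eq_bigr => w _; rewrite sum_switch.
rewrite /B1 /B2 /B3 /B4 -!big_split /= mulr_sumr -sumrB.
apply: le_trans (ler_norm_sum _ _ _) _; apply: ler_sum => u _.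
rewrite -!big_split /= mulr_sumr -sumrB.
apply: le_trans (ler_norm_sum _ _ _) _; apply: ler_sum => w _.
rewrite -!big_split /= mulr_sumr -sumrB.
apply: le_trans (ler_norm_sum _ _ _) _; apply: ler_sum => G _.
exact: switch_affected.
Qed.

End SwitchingStep.

(** * Inserting a cycle *)

Lemma bernoulli_le (R : realFieldType) (k : R) j : 0 <= k <= 1 ->
  1 - j%:R * k <= (1 - k) ^+ j.
Proof.
case/andP=> k0 k1; elim: j => [|j IH]; first by rewrite expr0 mul0r subr0.
rewrite exprS; apply: le_trans (ler_wpM2l _ IH); last by lra.
rewrite -natr1; have : 0 <= j%:R * k * k by rewrite !mulr_ge0.
lra.
Qed.

(** Here [q] stands for $d-1$ and [T] for $q^{r-1}$. From $q+1 \le 3q/2$ all coefficients add up to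
    at most $100qT$, and $2(q+1)/n \le 3q/n$; hence 300. *)
Lemma step_numeric (R : realFieldType) (q T rr Sg Dg k1 c0 c1 nn : R) :
  2 <= q -> q ^+ 2 <= T -> rr <= T -> 0 <= Sg -> 0 <= Dg ->
  q * Sg <= 2 * T -> q * Dg <= 4 * T -> 0 <= k1 ->
  k1 <= 2 * rr + 4 * (q + 1) + 2 * (q + 1) ^+ 2 ->
  0 < nn -> 0 <= c0 -> c1 <= 2 * (q + 1) / nn * c0 ->
  k1 * c1 + 2 * (2 * (q + 1) ^+ 2 * Dg * c1 + 2 * (q + 1) ^+ 2 * Sg * c1
     + 2 * (2 * (q + 1) / nn * (q + 1) ^+ 2 * Sg * c0))
   + 2 * (q + 1) / nn * (2 * (q + 1) ^+ 2 + (q + 1)) * c0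
  <= 300 * (q ^+ 2 * T / nn) * c0.
Proof.
move=> q2 qT rT S0 D0 qS qD k0 kle n0 c00 c1le.
set z := 2 * (q + 1) / nn * c0 in c1le *.
set B := k1 + 4 * (q + 1) ^+ 2 * Dg + 8 * (q + 1) ^+ 2 * Sg + 2 * (q + 1) ^+ 2 + (q + 1).
have dd0 : 0 <= (q + 1) ^+ 2 by rewrite exprn_ge0; lra.
have dd : (q + 1) ^+ 2 <= 9 / 4 * q ^+ 2.
  have -> : 9 / 4 * q ^+ 2 = (3 / 2 * q) ^+ 2 by field.
  by rewrite lerXn2r ?nnegrE; lra.
have T0 : 0 <= T by apply: le_trans qT; rewrite exprn_ge0; lra.
have qT0 : 2 * T <= q * T by rewrite ler_wpM2r.
have qq : 2 * q <= q ^+ 2 by rewrite expr2 ler_wpM2r; lra.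
have D1 : (q + 1) ^+ 2 * Dg <= 9 * (q * T).
  have : (q + 1) ^+ 2 * Dg <= 9 / 4 * q ^+ 2 * Dg by rewrite ler_wpM2r.
  have : q * (q * Dg) <= q * (4 * T) by rewrite ler_wpM2l //; lra.
  lra.
have S1 : (q + 1) ^+ 2 * Sg <= 9 / 2 * (q * T).
  have : (q + 1) ^+ 2 * Sg <= 9 / 4 * q ^+ 2 * Sg by rewrite ler_wpM2r.
  have : q * (q * Sg) <= q * (2 * T) by rewrite ler_wpM2l //; lra.
  lra.
have HB : B <= 100 * (q * T) by rewrite /B; lra.
have z0 : 0 <= z by rewrite /z mulr_ge0 // divr_ge0; lra.
apply: (@le_trans _ _ (B * z)).
  have E1 : k1 * c1 <= k1 * z by rewrite ler_wpM2l.
  have E2 : (q + 1) ^+ 2 * Dg * c1 <= (q + 1) ^+ 2 * Dg * z by apply: ler_wpM2l => //;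
    apply: mulr_ge0.
  have E3 : (q + 1) ^+ 2 * Sg * c1 <= (q + 1) ^+ 2 * Sg * z by apply: ler_wpM2l => //;
    apply: mulr_ge0.
  have E4 : 2 * (q + 1) / nn * (q + 1) ^+ 2 * Sg * c0 = (q + 1) ^+ 2 * Sg * z by rewrite /z;
    ring.
  have E5 : 2 * (q + 1) / nn * (2 * (q + 1) ^+ 2 + (q + 1)) * c0 = (2 * (q + 1) ^+ 2 + (q +
    1)) * z.
    by rewrite /z; ring.
  by rewrite E4 E5 /B; lra.
apply: (@le_trans _ _ (100 * (q * T) * (3 * q / nn * c0))); last first.
  by rewrite le_eqVlt; apply/orP; left; apply/eqP; field; lra.
apply: ler_pM => //; first by rewrite /B !addr_ge0 ?mulr_ge0 //; lra.
by rewrite /z ler_wpM2r // ler_pM2r ?invr_gt0 //; lra.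
Qed.

Section CycleInsertion.
Variables (R : realFieldType) (n d r : nat) (cI : {set edge_set n}).
Hypothesis cI_cycle : forall E : edge_set n, E \in cI -> is_cycle E /\ (cycle_length E <= r)%N.
Hypothesis d_ge3 : (3 <= d)%N.
Hypothesis r_ge3 : (3 <= r)%N.
Hypothesis size_nd : (2 * (r * (2 * r + 4 * d + 2 * d ^ 2)) <= n * d)%N.
Variable c : seq 'I_n.
Hypothesis c_uniq : uniq c.
Hypothesis c_ge3 : (3 <= size c)%N.
Hypothesis c_ler : (size c <= r)%N.
Variable h : edge_set n -> R.
Implicit Types (G E F : edge_set n).
Hypothesis h_le1 : forall G, `|h G| <= 1.
Hypothesis h_dep : forall G G',
  (forall E, E \in cI -> E != cycle_edges c -> (E \subset G) = (E \subset G')) -> h G = h G'.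
Local Notation graph_count := (@graph_count R n d).
Local Notation graph_sum := (@graph_sum R n d).
Let q : R := d.-1%:R.
(** [eps] is the relative error of inserting one edge; [kappa] bounds the proportion of ordered
    edges spoiled for a deletion. *)
Let eps : R := 300 * (q ^+ r.-1 / n%:R).
Let kappa : R := (2 * r + 4 * d + 2 * d ^ 2)%:R / (n%:R * d%:R).

Let d_gt0 : (0 < d)%N. Proof. by apply: leq_trans d_ge3. Qed.
Let n_gt0 : (0 < n)%N. Proof. by case: c c_ge3 => // v _ _;
  exact: leq_ltn_trans (leq0n v) (ltn_ord v). Qed.
Let nR : 0 < n%:R :> R. Proof. by rewrite ltr0n. Qed.
Let dR : 0 < d%:R :> R. Proof. by rewrite ltr0n. Qed.
Let dqE : d%:R = q + 1. Proof. by rewrite /q natr1 prednK. Qed.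
Let q_ge2 : 2 <= q. Proof. by rewrite /q (ler_nat R 2); case: d d_ge3. Qed.

Let size_nd' : (4 * (2 * r) + 8 * d + 4 * d ^ 2 <= n * d)%N.
Proof.
apply: leq_trans size_nd; clear -r_ge3.
case: r r_ge3 => // -[|[|r']] // _; move: (d ^ 2)%N => dd; nia.
Qed.

(** [size_nd] says precisely that $r\kappa \le 1/2$; Bernoulli's inequality does the rest. *)
Lemma kappa_bounds : 0 <= kappa <= 1 /\ (forall j, (j <= r)%N -> 2^-1 <= (1 - kappa) ^+ j).
Proof.
have k0 : 0 <= kappa by rewrite /kappa divr_ge0 ?mulr_ge0.
have rk : r%:R * kappa <= 2^-1.
  rewrite /kappa mulrA ler_pdivrMr ?mulr_gt0 // ler_pdivlMl // -!natrM ler_nat.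
  exact: size_nd.
have r1 : 1 <= r%:R :> R by rewrite ler1n (leq_trans _ r_ge3).
have k1 : kappa <= r%:R * kappa by rewrite -[leLHS]mul1r ler_wpM2r.
have K : 0 <= kappa <= 1 by rewrite k0 /=; lra.
split=> // j jr; apply: le_trans (bernoulli_le j K).
have : j%:R * kappa <= r%:R * kappa by rewrite ler_wpM2r // ler_nat.
lra.
Qed.

Lemma switching_step F x y : x != y -> [set x; y] \notin F ->
    [set x; y] |: F \subset cycle_edges c ->
  `|n%:R * d%:R * graph_sum h ([set x; y] |: F) -
     (d%:R - (degree F x)%:R) * (d%:R - (degree F y)%:R) * graph_sum h F| <=
  q ^+ 2 * eps * graph_count F.
Proof.
move=> xy xyF F0A.
have H1 := forward_count_error d xyF h_le1.
have H2 := switching_change cI_cycle d_gt0 n_gt0 size_nd' c_uniq c_ge3 c_ler xyF F0A h_le1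
  h_dep.
have H3 := backward_count_error d_gt0 n_gt0 r_ge3 size_nd' c_uniq c_ge3 c_ler xy xyF F0A h_le1.
set X1 := (X in `|_ - X| <= _) in H1.
set X0 := (X in `|_ - X| <= _) in H3.
set a1 := _ * _ * graph_sum h _ in H1 *.
set a0 := _ * _ * graph_sum h F in H3 *.
(* [X1] and [X0] sum [h] over the same switches, evaluated at the graph with [xy] and at the graph
   without it. *)
have -> : a1 - a0 = (a1 - X1) + (X1 - X0) - (a0 - X0) by ring.
apply: le_trans (ler_normB _ _) _.
apply: le_trans (lerD (ler_normD _ _) (lexx _)) _.
apply: le_trans (lerD (lerD H1 H2) H3) _.
have -> : q ^+ 2 * eps * graph_count F = 300 * (q ^+ 2 * q ^+ r.-1 / n%:R) * graph_count F.
  by rewrite /eps; ring.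
rewrite dqE; apply: (@step_numeric _ _ _ r%:R) => //.
- rewrite ler_weXn2l //; first by apply: le_trans q_ge2; rewrite ler1n.
  by clear -r_ge3; case: r r_ge3 => // -[|[|]].
- apply: (@le_trans _ _ (2 ^+ r.-1)); last by rewrite lerXn2r ?nnegrE.
  rewrite -natrX ler_nat; clear -r_ge3; case: r r_ge3 => // r' _ /=.
  exact: ltn_expl.
- by apply: sumr_ge0 => m _; rewrite exprn_ge0.
- by apply: sumr_ge0 => i _; apply: sumr_ge0 => m _; rewrite exprn_ge0.
- exact: geometric_sum_le.
- exact: geometric_double_sum_le.
- rewrite -dqE -natrX -!natrM -!natrD ler_nat !leq_add2r leq_pmul2l //.
  exact: leq_trans (leqnSn _) (card_F c_uniq c_ge3 c_ler xyF F0A).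
- exact: graph_count_ge0.
- rewrite -dqE; apply: edge_insertion_crude => //.
  apply: leq_trans size_nd'; rewrite !leq_add2r leq_pmul2l //.
  have := card_F c_uniq c_ge3 c_ler xyF F0A; clear.
  by move: #|_| => ?; lia.
Qed.

(** Invariant after [j] insertions, with [w] the product of the ideal factors. The last clause and
    [kappa_bounds] give [graph_count F <= 2 * (w * graph_count set0)], which turns the error of the
    next switch into one relative to [w]; the 2 in the middle clause is this loss. *)
Definition inserted F (w : R) j := [/\ 0 <= w,
  `|graph_sum h F - w * graph_sum h set0| <= 2 * eps * j%:R * w * graph_count set0 &
  graph_count F * (1 - kappa) ^+ j <= w * graph_count set0].

Lemma inserted_step F w j x y : x != y -> [set x; y] \notin F ->
    [set x; y] |: F \subset cycle_edges c -> (j <= r)%N ->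
    (degree F x <= 1)%N -> (degree F y <= 1)%N ->
  inserted F w j ->
  inserted ([set x; y] |: F)
    ((d%:R - (degree F x)%:R) * (d%:R - (degree F y)%:R) / (n%:R * d%:R) * w) j.+1.
Proof.
move=> xy xyF F0A jr dx dy [w0 H1 H2].
have [K Kj] := kappa_bounds; have k2 := Kj j jr.
have S := switching_step xy xyF F0A.
have I := edge_insertion R d xyF.
have nd0 : 0 < n%:R * d%:R :> R by rewrite mulr_gt0.
have e0 : 0 <= eps by rewrite /eps !mulr_ge0 ?invr_ge0 ?exprn_ge0.
have c0 : 0 <= graph_count F by apply: graph_count_ge0.
have c1 : 0 <= graph_count ([set x; y] |: F) by apply: graph_count_ge0.
have q2 : 2 <= q := q_ge2.
(* Degrees at most 1 make the error $q^2\,$[eps] of [switching_step] at most [eps] times the main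
   factor. *)
have qD : q ^+ 2 <= (d%:R - (degree F x)%:R) * (d%:R - (degree F y)%:R).
  have Hx : (degree F x)%:R <= 1 :> R by rewrite (ler_nat R _ 1).
  have Hy : (degree F y)%:R <= 1 :> R by rewrite (ler_nat R _ 1).
  have dq : d%:R = q + 1 := dqE.
  have q0 : 0 <= q by lra.
  by rewrite expr2; apply: ler_pM => //; rewrite dq; lra.
move: S I qD; set D := (d%:R - _) * (d%:R - _) => S I qD.
have D0 : 0 <= D by apply: le_trans qD; rewrite exprn_ge0.
set rho := D / (n%:R * d%:R).
have rho0 : 0 <= rho by rewrite divr_ge0 // ltW.
have cF : graph_count F <= 2 * (w * graph_count set0).
  have : graph_count F * 2^-1 <= graph_count F * (1 - kappa) ^+ j by rewrite ler_wpM2l.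
  lra.
split; first by rewrite mulr_ge0.
- have S' : `|graph_sum h ([set x; y] |: F) - rho * graph_sum h F| <= rho * eps * graph_count F.
    have -> : graph_sum h ([set x; y] |: F) - rho * graph_sum h F =
      (n%:R * d%:R * graph_sum h ([set x; y] |: F) - D * graph_sum h F) / (n%:R * d%:R).
      by rewrite /rho; field; rewrite !gt_eqF.
    have i0 : 0 <= (n%:R * d%:R)^-1 :> R by rewrite invr_ge0 ltW.
    rewrite normrM (ger0_norm i0) ler_pdivrMr //.
    apply: le_trans S _.
    have -> : rho * eps * graph_count F * (n%:R * d%:R) = D * (eps * graph_count F).
      by rewrite /rho; field; rewrite !gt_eqF.
    by rewrite -mulrA; apply: ler_wpM2r => //; apply: mulr_ge0.
  have -> : graph_sum h ([set x; y] |: F) - rho * w * graph_sum h set0 =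
    (graph_sum h ([set x; y] |: F) - rho * graph_sum h F) +
    rho * (graph_sum h F - w * graph_sum h set0) by ring.
  apply: le_trans (ler_normD _ _) _; rewrite normrM (ger0_norm rho0).
  apply: le_trans (lerD S' (ler_wpM2l rho0 H1)) _.
  have H3 : rho * eps * graph_count F <= rho * eps * (2 * (w * graph_count set0)).
    by apply: ler_wpM2l => //; apply: mulr_ge0.
  by rewrite -natr1; lra.
- have I' : graph_count ([set x; y] |: F) * (1 - kappa) <= rho * graph_count F.
    rewrite /rho mulrAC ler_pdivlMr //; apply: le_trans I.
    rewrite -mulrA mulrC; apply: ler_wpM2r => //.
    rewrite mulrBl mul1r lerD2l lerN2 /kappa divfK ?gt_eqF //.
    rewrite ler_nat !leq_add2r leq_pmul2l //.
    exact: leq_trans (leqnSn _) (card_F c_uniq c_ge3 c_ler xyF F0A).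
  rewrite exprS mulrA.
  apply: le_trans (ler_wpM2r _ I') _; first by rewrite exprn_ge0; lra.
  by rewrite -[leLHS]mulrA -[leRHS]mulrA; exact: (ler_wpM2l rho0 H2).
Qed.

Lemma path_edges_sub_cycle s : path_edges (n := n) s \subset path_edges c ->
  path_edges s \subset cycle_edges c.
Proof.
move=> /subset_trans; apply; move: c_uniq; case: c c_ge3 => // v p _ U.
by rewrite cycle_edges_cons // subsetUr.
Qed.

(** The path grows at its head. The first edge joins two vertices of degree 0; each later one joins
    a fresh vertex to an end of degree 1. The value 1 belongs to the path without edges. *)
Lemma inserted_path a t s : c = s ++ a :: t ->
  inserted (path_edges (a :: t))
    (if size t is j.+1 then d%:R / n%:R * (q / n%:R) ^+ j else 1) (size t).
Proof.
elim: t a s => [|b t IH] a s E.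
  by split; rewrite // ?path_edges1 ?mul1r ?subrr ?normr0 ?mulr0 ?mul0r // expr0 mulr1.
have {}IH := IH b (rcons s a); rewrite cat_rcons in IH; have {}IH := IH E.
have U : uniq (a :: b :: t) by move: c_uniq; rewrite E cat_uniq => /and3P[].
have ab : b != a by move: U => /=; rewrite inE negb_or eq_sym => /andP[/andP[]].
have Ub : uniq (b :: t) by move: U => /= /andP[].
have abt : a \notin b :: t by move: U; rewrite cons_uniq => /andP[].
have dega : degree (path_edges (b :: t)) a = 0%N.
  rewrite degree_path_edges //; have /negPf -> : a \notin t.
    by move: abt; rewrite inE negb_or => /andP[].
  by case: (boolP (a \in _)) => // /mem_belast; rewrite (negPf abt).
have degb : degree (path_edges (b :: t)) b = (0 < size t)%N.
  rewrite degree_path_edges //; have /negPf -> : b \notin t by move: Ub => /= /andP[].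
  by case: (t) => //= u t'; rewrite mem_head.
have EE : path_edges (a :: b :: t) = [set b; a] |: path_edges (b :: t).
  by rewrite path_edges_cons2 [[set b; a]]setUC.
have sub : [set b; a] |: path_edges (b :: t) \subset cycle_edges c.
  by rewrite -EE path_edges_sub_cycle // E path_edges_cat subsetUr.
have st : (size t <= r)%N.
  by apply: leq_trans c_ler; rewrite E size_cat /= !addnS; clear; lia.
have baN : [set b; a] \notin path_edges (b :: t) by rewrite setUC cons2_edge_notin.
have := inserted_step ab baN sub st _ _ IH; rewrite dega degb EE => /(_ (leq_b1 _) isT).
rewrite /=; case: (size t) => [|j] /=; rewrite !subr0.
  by rewrite expr0 !mulr1 -mulf_div divff ?mulr1 // gt_eqF.
rewrite (_ : (d%:R - 1) * d%:R / (n%:R * d%:R) * (d%:R / n%:R * (q / n%:R) ^+ j) =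
  d%:R / n%:R * (q / n%:R) ^+ j.+1) // exprS dqE; field.
by rewrite -dqE !gt_eqF.
Qed.

(** The closing edge joins two ends of degree 1; its factor $(d-1)^2/(nd)$ makes up for the first
    factor $d/n$. The constant is twice 300. *)
Theorem cycle_insertion :
  `|graph_sum h (cycle_edges c) - (q / n%:R) ^+ size c * graph_sum h set0| <=
  600 * (q ^+ r.-1 / n%:R) * (size c)%:R * (q / n%:R) ^+ size c * graph_count set0.
Proof.
case Ec : c c_ge3 => [//|a t] s3.
have Uc : uniq (a :: t) by rewrite -Ec.
case/lastP: t Ec s3 Uc => [//|t b] Ec s3 Uc.
have IH := @inserted_path a (rcons t b) [::] Ec.
have t0 : t != [::] by move: s3; rewrite /= size_rcons; case: (t).
have ba : b != a by move: Uc => /= /andP[+ _]; apply: contraNneq => ->;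
  rewrite mem_rcons mem_head.
have EE := cycle_edges_rcons Uc.
have baN : [set b; a] \notin path_edges (a :: rcons t b) by rewrite setUC path_edges_closing.
have sub : [set b; a] |: path_edges (a :: rcons t b) \subset cycle_edges c by rewrite -EE Ec.
have st : (size (rcons t b) <= r)%N.
  by apply: leq_trans c_ler; rewrite Ec /= leqnSn.
have dega : degree (path_edges (a :: rcons t b)) a = 1%N.
  rewrite degree_path_edges // belast_rcons mem_head.
  by have /negPf -> : a \notin rcons t b by move: Uc => /= /andP[].
have degb : degree (path_edges (a :: rcons t b)) b = 1%N.
  rewrite degree_path_edges // belast_rcons mem_rcons mem_head.
  have /negPf -> // : b \notin a :: t.
  by move: Uc; rewrite -rcons_cons rcons_uniq => /andP[].
have := inserted_step ba baN sub st _ _ IH; rewrite dega degb -EE => /(_ isT isT)[_ + _].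
rewrite /= size_rcons.
have -> : (d%:R - 1) * (d%:R - 1) / (n%:R * d%:R) * (d%:R / n%:R * (q / n%:R) ^+ size t) =
  (q / n%:R) ^+ (size t).+2 by rewrite !exprS dqE; field; rewrite -dqE !gt_eqF.
move=> H; apply: le_trans H _; rewrite /eps.
by rewrite le_eqVlt; apply/orP; left; apply/eqP; ring.
Qed.

End CycleInsertion.

(** * Replacing one coordinate at a time *)

Section Resampling.
Variables (R : realFieldType) (I : finType) (p0 p1 : I -> R).
Implicit Types (a : I) (f : {set I} -> R) (W V : {set I}) (s : seq I).

Definition resample a f W : R := p0 a * f (W :\ a) + p1 a * f (a |: W).

Definition pattern_weight s V : R := \prod_(a <- s) (if a \in V then p1 a else p0 a).

(** Of the two branches of [resample] only the one that agrees with [V] at [a] can lead to [V]; the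
    next lemma excludes the other. *)
Lemma setD_cons_eq a s V W (b := a \in V) : a \notin s ->
  (V :\: [set u in s] == (if b then a |: W else W :\ a) :\: [set u in s]) =
  (V :\: [set u in a :: s] == W :\: [set u in a :: s]).
Proof.
move=> as_; apply/eqP/eqP => /setP H; apply/setP => u; move: (H u); rewrite !inE.
  have [->|ua] := eqVneq u a; first by [].
  by case: (b); rewrite !inE ?(negPf ua).
have [->|ua] := eqVneq u a; last by case: (b); rewrite !inE ?(negPf ua) ?ua.
by rewrite as_ /= => _; rewrite /b; case: (a \in V); rewrite !inE eqxx.
Qed.

Lemma setD_cons_neq a s V W (b := a \in V) : a \notin s ->
  (V :\: [set u in s] == (if b then W :\ a else a |: W) :\: [set u in s]) = false.
Proof.
move=> as_; apply/negbTE/eqP => /setP/(_ a); rewrite !inE as_ /= /b.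
by case: (a \in V); rewrite !inE eqxx.
Qed.

Lemma foldr_resample s f W : uniq s -> foldr resample f s W =
  \sum_(V : {set I} | V :\: [set u in s] == W :\: [set u in s]) pattern_weight s V * f V.
Proof.
elim: s W => [|a s IH] W /=.
  move=> _; have E : [set u in [::]] = set0 :> {set I} by apply/setP => u; rewrite !inE.
  rewrite (big_pred1 W); last by move=> V; rewrite /= E !setD0.
  by rewrite /pattern_weight big_nil mul1r.
case/andP=> as_ Us; rewrite /resample !IH // !mulr_sumr.
rewrite [X in X + _ = _]big_mkcond [X in _ + X = _]big_mkcond -big_split [RHS]big_mkcond /=;
  apply: eq_bigr => V _.
rewrite /pattern_weight big_cons -/(pattern_weight s V).
have := setD_cons_eq V W as_; have := setD_cons_neq V W as_; rewrite /=.
by case: (a \in V) => -> ->; case: ifP => _; rewrite ?addr0 ?add0r ?mulrA.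
Qed.

Hypothesis p0_ge0 : forall a, 0 <= p0 a.
Hypothesis p1_ge0 : forall a, 0 <= p1 a.
Hypothesis p_le1 : forall a, p0 a + p1 a <= 1.

Lemma resample_le1 a f : (forall W, `|f W| <= 1) -> forall W, `|resample a f W| <= 1.
Proof.
move=> f1 W; apply: le_trans (p_le1 a); apply: le_trans (ler_normD _ _) _.
by rewrite !normrM !(ger0_norm (p0_ge0 _)) !(ger0_norm (p1_ge0 _)) lerD // ler_piMr.
Qed.

(** Telescoping: the one-step bound is applied to a function that is already partly resampled, so it
    is assumed for every bounded function, and boundedness is carried through the induction. *)
Lemma foldr_resample_error (T : finType) (D : {pred T}) (X : T -> {set I}) (err : I -> R) s f :
    (forall a f, a \in s -> (forall W, `|f W| <= 1) ->
       `|\sum_(t in D) f (X t) - \sum_(t in D) resample a f (X t)| <= err a) ->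
    (forall W, `|f W| <= 1) ->
  (forall W, `|foldr resample f s W| <= 1) /\
  `|\sum_(t in D) f (X t) - \sum_(t in D) foldr resample f s (X t)| <= \sum_(a <- s) err a.
Proof.
elim: s => [|a s IH] H f1 /=; first by rewrite subrr normr0 big_nil.
have [|g1 Hs] := IH _ f1; first by move=> b g bs; apply: H; rewrite inE bs orbT.
split; first exact: resample_le1.
rewrite big_cons; set S0 := \sum_(t in D) f _; set S1 := \sum_(t in D) foldr _ _ _ _ in Hs.
set S2 := \sum_(t in D) _.
have -> : S0 - S2 = (S1 - S2) + (S0 - S1) by ring.
apply: le_trans (ler_normD _ _) _; apply: lerD Hs.
by apply: H; rewrite ?mem_head.
Qed.

End Resampling.

(** * Resampling one cycle of the random graph *)

Section ResamplingCycles.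
Variables (R : realFieldType) (n d r : nat) (cI : {set edge_set n}).
Hypothesis cI_cycle : forall E : edge_set n, E \in cI -> is_cycle E /\ (cycle_length E <= r)%N.
Hypothesis d_ge3 : (3 <= d)%N.
Hypothesis r_ge3 : (3 <= r)%N.
Hypothesis size_nd : (2 * (r * (2 * r + 4 * d + 2 * d ^ 2)) <= n * d)%N.
Implicit Types (G E F : edge_set n).
Let q : R := d.-1%:R.

Definition cycles_in G : {set edge_set n} := [set E in cI | E \subset G].

Lemma graph_sum0 (h : edge_set n -> R) :
  graph_sum d h set0 = \sum_(G in regular_graphs n d) h G.
Proof. by apply: eq_bigl => G; rewrite sub0set andbT. Qed.

Lemma norm_graph_sum_le (h : edge_set n -> R) F : (forall G, `|h G| <= 1) ->
  `|graph_sum d h F| <= graph_count R d F.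
Proof.
by move=> h1; apply: le_trans (ler_norm_sum _ _ _) _; apply: ler_sum.
Qed.

Lemma resample_cycle_error (p0 p1 : edge_set n -> R) (lam : R) A f
    (mu := (q / n%:R) ^+ cycle_length A) :
    A \in cI -> `|1 - lam - p0 A| <= lam ^+ 2 -> `|lam - p1 A| <= lam ^+ 2 ->
    (forall W, `|f W| <= 1) ->
  `|graph_sum d (fun G => f (cycles_in G)) set0 -
    graph_sum d (fun G => resample p0 p1 A f (cycles_in G)) set0| <=
  (1200 * (q ^+ r.-1 / n%:R) * (cycle_length A)%:R * mu
    + 2 * `|lam - mu| + 2 * lam ^+ 2) * @graph_count R n d set0.
Proof.
move=> AI P0 P1 f1.
have [[c [Uc c3 Ec]] cr] := cI_cycle AI.
have lA : cycle_length A = size c by rewrite /cycle_length Ec card_cycle_edges.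
pose h0 G := f (cycles_in G :\ A); pose h1 G := f (A |: cycles_in G).
have depW G G' : (forall E, E \in cI -> E != cycle_edges c -> (E \subset G) = (E \subset G')) ->
    cycles_in G :\ A = cycles_in G' :\ A.
  move=> H; apply/setP => E; rewrite !inE.
  by case: (eqVneq E A) => //= EA; case: (boolP (E \in cI)) => //= EI; rewrite H // -Ec.
have I0 : `|graph_sum d h0 A - mu * graph_sum d h0 set0| <=
    600 * (q ^+ r.-1 / n%:R) * (cycle_length A)%:R * mu * @graph_count R n d set0.
  rewrite /mu lA Ec; rewrite lA in cr.
  apply: (cycle_insertion cI_cycle d_ge3 r_ge3 size_nd Uc c3 cr) => [G|G G' /depW];
    first exact: f1.
  by move=> EG; rewrite /h0 EG.
have I1 : `|graph_sum d h1 A - mu * graph_sum d h1 set0| <=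
    600 * (q ^+ r.-1 / n%:R) * (cycle_length A)%:R * mu * @graph_count R n d set0.
  rewrite /mu lA Ec; rewrite lA in cr.
  apply: (cycle_insertion cI_cycle d_ge3 r_ge3 size_nd Uc c3 cr) => [G|G G' /depW];
    first exact: f1.
  move=> EG.
  have U1 W : A |: W = A |: (W :\ A) by apply/setP => E; rewrite !inE; case: (E == A).
  by rewrite /h1 U1 EG -U1.
have N0 := norm_graph_sum_le set0 (fun G => f1 _ : `|h0 G| <= 1).
have N1 := norm_graph_sum_le set0 (fun G => f1 _ : `|h1 G| <= 1).
(* [f (cycles_in G)] is [h1 G] if [A] lies in [G] and [h0 G] otherwise; now [h0] and [h1] are test
   functions blind to [A]. *)
have -> : graph_sum d (fun G => f (cycles_in G)) set0 =
    graph_sum d h0 set0 - graph_sum d h0 A + graph_sum d h1 A.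
  rewrite !graph_sum0 /graph_sum [X in _ - X + _]big_mkcondr [X in _ + X]big_mkcondr /=.
  rewrite -sumrB -big_split /=; apply: eq_bigr => G _.
  case: (boolP (A \subset G)) => AG.
    rewrite subrr add0r /h1; congr f; apply/setP => E; rewrite !inE.
    by case: eqP => // ->; rewrite AI AG.
  rewrite subr0 addr0 /h0; congr f; apply/setP => E; rewrite !inE.
  by case: eqP => // ->; rewrite (negPf AG) andbF.
have -> : graph_sum d (fun G => resample p0 p1 A f (cycles_in G)) set0 =
    p0 A * graph_sum d h0 set0 + p1 A * graph_sum d h1 set0.
  by rewrite /graph_sum !mulr_sumr -big_split.
move: I0 I1 N0 N1; set g0A := graph_sum d h0 A; set g1A := graph_sum d h1 A.
set g0 := graph_sum d h0 set0; set g1 := graph_sum d h1 set0.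
set N := @graph_count R n d set0; set e := 600 * _ * _ * mu * _ => I0 I1 N0 N1.
(* Two insertion errors (600 each), and for each of [g0], [g1] the errors of [lam] against [mu] and
   of the weight against [1 - lam] or [lam]. *)
have -> : g0 - g0A + g1A - (p0 A * g0 + p1 A * g1) =
  (g1A - mu * g1) - (g0A - mu * g0) + (1 - lam - p0 A + (lam - mu)) * g0 + (mu - lam + (lam -
    p1 A)) * g1.
  by ring.
have B0 : `|(1 - lam - p0 A + (lam - mu)) * g0| <= (lam ^+ 2 + `|lam - mu|) * N.
  by rewrite normrM ler_pM // (le_trans (ler_normD _ _)) // lerD.
have B1 : `|(mu - lam + (lam - p1 A)) * g1| <= (`|lam - mu| + lam ^+ 2) * N.
  by rewrite normrM ler_pM // (le_trans (ler_normD _ _)) // lerD // distrC.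
apply: le_trans (ler_normD _ _) _; apply: le_trans (lerD (ler_normD _ _) B1) _.
apply: le_trans (lerD (lerD (ler_normB _ _) B0) (lexx _)) _.
by rewrite /e in I0 I1; lra.
Qed.

End ResamplingCycles.

(** As $3^8 \ge 2000$, $2000r^2 \le n$. Then $12rd \le n$: for $d \le r$ from $r^2$, for $d > r$
    from $d^3 \le n$ if $d \ge 12$, and otherwise from $d^2 \le 121$. Each of $4r^2$, $8rd$, $4rd^2$
    is thus at most $nd/3$. *)
Lemma regime_bounds (n d r : nat) : (3 <= d)%N -> (3 <= r)%N -> (r ^ 10 <= n)%N ->
  (d ^ 3 <= n)%N ->
  (2 * (r * (2 * r + 4 * d + 2 * d ^ 2)) <= n * d)%N /\ (2 * r ^ 2 <= n)%N.
Proof.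
move=> d3 r3 rn dn.
have H8 : (2000 <= r ^ 8)%N by apply: (@leq_trans (3 ^ 8)); rewrite ?leq_exp2r.
have rr : (2000 * r ^ 2 <= n)%N.
  by apply: leq_trans rn; rewrite -[10%N]/(8 + 2)%N expnD leq_mul2r H8 orbT.
have r2 : (r ^ 2 = r * r)%N by rewrite mulnn.
have rd : (12 * (r * d) <= n)%N.
  case: (leqP d r) => [dr|/ltnW rd].
    have : (r * d <= r * r)%N by rewrite leq_mul2l dr orbT.
    by move: rr; rewrite r2; move: (r * r)%N (r * d)%N; clear; lia.
  have rdd : (r * d <= d * d)%N by rewrite leq_mul2r rd orbT.
  case: (leqP 12 d) => [d12|d12].
    have : (12 * (d * d) <= n)%N.
      by apply: leq_trans dn; rewrite [(d ^ 3)%N]expnS -mulnn leq_mul2r d12 orbT.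
    by move: rdd; move: (d * d)%N (r * d)%N; clear; lia.
  have : (d * d <= 11 * 11)%N by apply: leq_mul.
  have : (3 * 3 <= r * r)%N by apply: leq_mul.
  by move: rdd rr; rewrite r2; move: (d * d)%N (r * d)%N (r * r)%N; clear; lia.
split; last by clear -rr r2; lia.
rewrite -[(d ^ 2)%N]mulnn; clear -rr r2 rd d3 r3.
have H1 : (12 * (r * r) <= n)%N by rewrite -r2; lia.
have H2 : (24 * r <= n)%N by nia.
have H3 : (12 * (r * d) * d <= n * d)%N by rewrite leq_mul2r rd orbT.
have H4 : (24 * r * d <= n * d)%N by rewrite leq_mul2r H2 orbT.
have H5 : (12 * (r * r) * 1 <= n * d)%N by apply: leq_mul => //; lia.
nia.
Qed.

Lemma ffact_ge (n k : nat) : ((n - k) ^ k <= n ^_ k)%N.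
Proof.
rewrite ffact_prod -[X in (_ ^ X)%N]card_ord -prod_nat_const.
by apply: leq_prod => i _; apply: leq_sub2l; apply: ltnW.
Qed.

(** By Bernoulli $[n]_k \ge (n-k)^k \ge n^k(1-t)$ with $t = k^2/n \le 1/2$, so $\mu \le \lambda \le
    2\mu$ and $\lambda-\mu \le t\lambda \le 2t\mu$. *)
Lemma poisson_rate_close (R : realFieldType) (q : R) (n k : nat) :
    0 <= q -> (0 < n)%N -> (2 * k ^ 2 <= n)%N ->
  let mu := (q / n%:R) ^+ k in let lam := q ^+ k / (n ^_ k)%:R in
  [/\ 0 <= mu, `|lam - mu| <= 2 * (k ^ 2)%:R / n%:R * mu & lam <= 2 * mu].
Proof.
move=> q0 n0 kn mu lam.
have nR : 0 < n%:R :> R by rewrite ltr0n.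
have kn' : (k <= n)%N by clear -kn; nia.
have mu0 : 0 <= mu by rewrite exprn_ge0 // divr_ge0 // ltW.
pose t : R := (k ^ 2)%:R / n%:R.
have t0 : 0 <= t by rewrite divr_ge0 // ltW.
have t1 : 2 * t <= 1 by rewrite /t mulrA ler_pdivrMr // mul1r -natrM ler_nat.
have nX : 0 < n%:R ^+ k :> R by rewrite exprn_gt0.
have ff0 : 0 < (n ^_ k)%:R :> R by rewrite ltr0n ffact_gt0.
have ffle : (n ^_ k)%:R <= n%:R ^+ k :> R.
  rewrite -natrX ler_nat ffact_prod -[X in (_ <= _ ^ X)%N]card_ord -prod_nat_const.
  by apply: leq_prod => i _; apply: leq_subr.
have ffge : n%:R ^+ k * (1 - t) <= (n ^_ k)%:R.
  apply: (@le_trans _ _ ((n - k)%N%:R ^+ k)); last by rewrite -natrX ler_nat ffact_ge.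
  have -> : (n - k)%N%:R = n%:R * (1 - k%:R / n%:R) :> R.
    by rewrite natrB // mulrBr mulr1 mulrCA divff ?gt_eqF // mulr1.
  rewrite exprMn ler_pM2l //.
  have -> : t = k%:R * (k%:R / n%:R) by rewrite /t natrX expr2 mulrA.
  apply: bernoulli_le; rewrite divr_ge0 ?ler0n //=.
  by rewrite ler_pdivrMr // mul1r ler_nat.
have muE : mu = q ^+ k / n%:R ^+ k by rewrite /mu exprMn exprVn.
have lamE : lam * (n ^_ k)%:R = mu * n%:R ^+ k.
  by rewrite muE /lam !divfK ?gt_eqF.
have lam0 : 0 <= lam by rewrite divr_ge0 ?exprn_ge0 // ltW.
have lo : mu <= lam.
  rewrite -(ler_pM2r ff0) lamE; exact: ler_wpM2l.
have hi : lam * (1 - t) <= mu.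
  rewrite -(ler_pM2r nX) -lamE -mulrA; apply: ler_wpM2l => //.
  by rewrite mulrC.
have lt : 2 * t * lam <= lam by rewrite -[leRHS]mul1r ler_wpM2r.
have hi2 : lam <= 2 * mu by lra.
split=> //; rewrite ger0_norm ?subr_ge0 //.
have -> : 2 * (k ^ 2)%:R / n%:R * mu = 2 * t * mu by rewrite /t; ring.
have : t * lam <= t * (2 * mu) by rewrite ler_wpM2l.
lra.
Qed.

(** All errors are compared with $k\mu T$, where $T = q^{r-1}/n$: $k \le r \le 2^{r-1}$ gives $k/n
    \le T$, and $\mu \le q/n \le T$. Then $1212 = 1200 + 2\cdot 2 + 2\cdot 4$. *)
Lemma cycle_error_numeric (R : realFieldType) (q : R) (n k r : nat)
    (mu := (q / n%:R) ^+ k) (lam := q ^+ k / (n ^_ k)%:R) :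
    2 <= q -> q <= n%:R -> (0 < n)%N -> (1 <= k)%N -> (k <= r)%N -> (3 <= r)%N ->
    (2 * r ^ 2 <= n)%N ->
  1200 * (q ^+ r.-1 / n%:R) * k%:R * mu + 2 * `|lam - mu| + 2 * lam ^+ 2 <=
  1212 * k%:R * q ^+ (k + r - 1) / n%:R ^+ (k + 1).
Proof.
move=> q2 qn n0 k1 kr r3 rn.
have nR : 0 < n%:R :> R by rewrite ltr0n.
have q0 : 0 <= q by lra.
have kn : (2 * k ^ 2 <= n)%N by apply: leq_trans rn; rewrite leq_pmul2l // leq_sqr.
have [mu0 H1 H2] := poisson_rate_close q0 n0 kn.
rewrite -/mu -/lam in mu0 H1 H2.
pose T := q ^+ r.-1 / n%:R.
have -> : 1212 * k%:R * q ^+ (k + r - 1) / n%:R ^+ (k + 1) = 1212 * (k%:R * mu * T).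
  have -> : (k + r - 1 = k + r.-1)%N by clear -r3; lia.
  rewrite /mu /T exprMn exprVn !exprD expr1 invfM; ring.
have T0 : 0 <= T by rewrite divr_ge0 ?exprn_ge0 // ltW.
have kR : 1 <= k%:R :> R by rewrite ler1n.
have kT : k%:R / n%:R <= T.
  rewrite /T ler_pM2r ?invr_gt0 //; apply: (@le_trans _ _ (2 ^+ r.-1)).
    rewrite -natrX ler_nat; apply: leq_trans kr _; clear -r3; case: r r3 => // r' _ /=.
    exact: ltn_expl.
  by rewrite lerXn2r ?nnegrE.
have qT : q / n%:R <= T.
  rewrite /T ler_pM2r ?invr_gt0 // -[leLHS]expr1 ler_weXn2l //; first by lra.
  by clear -r3; case: r r3 => // -[|[|]].
have qn0 : 0 <= q / n%:R by rewrite divr_ge0 // ltW.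
have qn1 : q / n%:R <= 1 by rewrite ler_pdivrMr // mul1r.
have muT : mu <= T.
  apply: le_trans qT; rewrite /mu -(prednK k1) exprS -[leRHS]mulr1.
  by apply: ler_wpM2l => //; apply: exprn_ile1.
have E1 : `|lam - mu| <= 2 * (k%:R * mu * T).
  apply: le_trans H1 _.
  have -> : 2 * (k ^ 2)%:R / n%:R * mu = 2 * (k%:R * mu * (k%:R / n%:R)).
    by rewrite natrX; ring.
  by rewrite ler_pM2l // ler_wpM2l ?mulr_ge0.
have lam0 : 0 <= lam by rewrite divr_ge0 ?exprn_ge0.
have E2 : lam ^+ 2 <= 4 * (k%:R * mu * T).
  have mu20 : 0 <= 2 * mu by apply: mulr_ge0.
  apply: (@le_trans _ _ ((2 * mu) ^+ 2)); first by rewrite lerXn2r.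
  have -> : (2 * mu) ^+ 2 = 4 * (1 * mu * mu) by ring.
  rewrite ler_pM2l //; apply: ler_pM => //; first by rewrite mul1r.
  exact: ler_wpM2r.
rewrite -/T; lra.
Qed.

From mathcomp Require Import all_classical all_reals all_analysis.

(** * Discrete and Poisson laws *)

Lemma poisson_weights_close (R : realType) (lam : R) : 0 <= lam ->
  `|1 - lam - expR (- lam)| <= lam ^+ 2 /\ `|lam - lam * expR (- lam)| <= lam ^+ 2.
Proof.
move=> l0; have e1 := expR_ge1Dx (- lam); have e2 := expR_ge1Dx lam.
have e0 := expR_gt0 (- lam).
(* Multiply by $1+\lambda$: $(1+\lambda)e^{-\lambda} \le 1 \le 1+\lambda^3$. *)
have e3 : expR (- lam) <= 1 - lam + lam ^+ 2.
  have ee : expR lam * expR (- lam) = 1 by rewrite -expRD subrr expR0.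
  have H : (1 + lam) * expR (- lam) <= (1 + lam) * (1 - lam + lam ^+ 2).
    apply: (@le_trans _ _ 1); first by rewrite (le_trans (ler_wpM2r (ltW e0) e2)) // ee.
    have -> : (1 + lam) * (1 - lam + lam ^+ 2) = 1 + lam ^+ 3 by ring.
    by rewrite lerDl exprn_ge0.
  by rewrite -(ler_pM2l (_ : 0 < 1 + lam)) //; lra.
split; first by rewrite ler0_norm; lra.
have -> : lam - lam * expR (- lam) = lam * (1 - expR (- lam)) by ring.
have e4 : expR (- lam) <= 1 by rewrite -expR0 ler_expR oppr_le0.
rewrite ger0_norm ?mulr_ge0 ?subr_ge0 // expr2 ler_wpM2l //; lra.
Qed.

Lemma root_bound_pow (R : realType) (m n k : nat) : (0 < k)%N ->
  m%:R <= n%:R `^ (k%:R^-1) :> R -> (m ^ k <= n)%N.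
Proof.
move=> k0 H; rewrite -(ler_nat R) natrX.
have -> : n%:R = (n%:R `^ (k%:R^-1)) ^+ k :> R.
  by rewrite -powR_mulrn ?powR_ge0 // -powRrM mulVf ?powRr1 // pnatr_eq0 -lt0n.
by rewrite lerXn2r ?nnegrE ?powR_ge0.
Qed.

Section DiscreteLaws.
Context {R : realType} {dO : measure_display} {Omega : measurableType dO}.
Variable P : probability Omega R.
Local Open Scope classical_set_scope.
Local Open Scope ereal_scope.

Lemma measure_preimage_fin (S : finType) (X : Omega -> S) (A : set S) :
    (forall x, measurable (X @^-1` [set x])) ->
  measurable (X @^-1` A) /\ P (X @^-1` A) = \sum_(x | x \in A) P (X @^-1` [set x]).
Proof.
move=> mX; have EA : X @^-1` A = \bigcup_(x in A) X @^-1` [set x].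
  by apply/seteqP; split=> [w Aw|w [x Ax /= ->]] //; exists (X w).
have fA : finite_set A by exact: finite_finset.
split; first by rewrite EA; apply: fin_bigcup_measurable.
rewrite EA measure_fin_bigcup //; last exact: trivIset_preimage1.
have EA' : A = [set` enum [pred x | x \in A]].
  by apply/seteqP; split=> x /=; rewrite mem_enum !inE.
by rewrite [in LHS]EA' -fsbig_seq ?enum_uniq //= big_enum.
Qed.

(** Needed because [is_poisson] only asserts that some rate exists; the prescribed mean then
    identifies it. *)
Lemma poisson_expectation (X : {RV P >-> nat}) (rate : R) : (0 < rate)%R ->
    (forall k, P (X @^-1` [set k]) = (poisson_pmf rate k)%:E) ->
  'E_P[fun w => (X w)%:R] = rate%:E.
Proof.
move=> r0 HX.
have mX k : measurable (X @^-1` [set k]) by exact: measurable_funPTI.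
have cover : \bigcup_k X @^-1` [set k] = setT.
  by apply/seteqP; split=> // w _; exists (X w).
have triv : trivIset setT (fun k => X @^-1` [set k]) by exact: trivIset_preimage1.
(* The total mass is read off from the fibres of [X], without summing the exponential series. *)
have sum1 : \sum_(0 <= k <oo) (poisson_pmf rate k)%:E = 1.
  rewrite -(probability_setT P) -cover measure_bigcup //.
  rewrite [RHS](eq_eseriesl (Q := xpredT)); last by move=> k; rewrite in_setT.
  by apply: eq_eseriesr => k _; exact/esym/HX.
rewrite unlock -cover ge0_integral_bigcup //; last first.
  move=> _ Y mY; rewrite cover setTI.
  rewrite (_ : _ @^-1` Y = X @^-1` ((fun k : nat => (k%:R)%:E) @^-1` Y)) //.
  exact: measurable_funPTI.
rewrite (eq_eseriesr (g := fun k => (k%:R * poisson_pmf rate k)%:E)); last first.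
  move=> k _; rewrite (eq_integral (cst (k%:R)%:E)); last first.
    by move=> w; rewrite inE /= => ->.
  by rewrite integral_cst // EFinM; congr (_ * _); exact: HX.
have pos k : 0 <= (k%:R * poisson_pmf rate k)%:E.
  by rewrite lee_fin mulr_ge0 ?poisson_pmf_ge0.
(* The term at 0 vanishes, and the shifted terms are [rate] times the mass at $k-1$. *)
rewrite nneseries_recl //= mul0r add0e.
rewrite -nneseries_addn //.
rewrite (eq_eseriesr (g := fun k => rate%:E * (poisson_pmf rate k)%:E)); last first.
  move=> k _; rewrite -EFinM /poisson_pmf r0 addn1 factS natrM exprS; congr EFin.
  have k1 : (k.+1%:R != 0 :> R)%R by rewrite pnatr_eq0.
  by rewrite invfM; move: (k.+1%:R : R) k1 (k`!%:R^-1)%R => t t0 u; field.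
by rewrite nneseriesZl ?sum1 ?mule1 // => k _; rewrite lee_fin poisson_pmf_ge0.
Qed.

End DiscreteLaws.

Section JointLaw.
Context {R : realType} {dO : measure_display} {Omega : measurableType dO}.
Variables (Q : probability Omega R) (n : nat) (cI : {set edge_set n}).
Variable Z : cycle_index cI -> {RV Q >-> nat}.
Hypothesis indep : mutually_independent Z.
Local Open Scope classical_set_scope.

Lemma joint_preimage1 (v : {ffun cycle_index cI -> nat}) :
  joint_vector Z @^-1` [set v] =
  \bigcap_(i in [set i | i \in [set: cycle_index cI]%SET]) (Z i @^-1` [set v i]).
Proof.
apply/seteqP; split=> w /= H.
  by move=> i _ /=; rewrite -H ffunE.
by apply/ffunP => i; rewrite ffunE; apply: H; rewrite /= finset.in_setT.
Qed.

Lemma measurable_joint1 v : measurable (joint_vector Z @^-1` [set v]).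
Proof.
rewrite joint_preimage1; apply: fin_bigcap_measurable; first exact: finite_finset.
by move=> i _; exact: measurable_funPTI.
Qed.

Lemma measurable_joint (A : set {ffun cycle_index cI -> nat}) :
  measurable (joint_vector Z @^-1` A).
Proof.
have -> : joint_vector Z @^-1` A = \bigcup_v (joint_vector Z @^-1` ([set v] `&` A)).
  apply/seteqP; split=> w /=; first by exists (joint_vector Z w).
  by case=> v _ [].
apply: countable_bigcupT_measurable; first exact: countableP.
move=> v; have [Av|nAv] := pselect (A v).
  rewrite (_ : [set v] `&` A = [set v]) ?measurable_joint1 //.
    exact: measurable_joint1.
  by apply/seteqP; split=> u /= [] // ->.
rewrite (_ : [set v] `&` A = set0); first by rewrite preimage_set0.
by apply/seteqP; split=> u //= [-> ].
Qed.

Lemma joint_law v :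
  Q (joint_vector Z @^-1` [set v]) = (\prod_a Q (Z a @^-1` [set v a]))%E.
Proof.
rewrite joint_preimage1 indep; apply: eq_bigl => a; exact: finset.in_setT.
Qed.

End JointLaw.

(** * Total variation distance *)

Section TotalVariation.
Variables (R : realType) (n d r : nat) (cI : {set edge_set n}).
Context {dO dO2 : measure_display} {Omega : measurableType dO} {Omega2 : measurableType dO2}.
Variables (P : probability Omega R) (G : Omega -> edge_set n).
Variables (Q : probability Omega2 R) (Z : cycle_index cI -> {RV Q >-> nat}).
Hypothesis d_ge3 : (3 <= d)%N.
Hypothesis r_ge3 : (3 <= r)%N.
Hypothesis r_le : (r ^ 10 <= n)%N.
Hypothesis d_le : (d ^ 3 <= n)%N.
Hypothesis G_unif : uniform_on P (regular_graphs n d) G.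
Hypothesis cI_cycle : forall E : edge_set n, E \in cI -> is_cycle E /\ (cycle_length E <= r)%N.
Implicit Types (E : edge_set n) (V : {set edge_set n}).

Definition cycle_rate E : R :=
  (d%:R - 1) ^+ cycle_length E / (n ^_ cycle_length E)%:R.

Hypothesis Z_law : forall a k,
  Q ((Z a : Omega2 -> nat) @^-1` [set k])%classic = (poisson_pmf (cycle_rate (val a)) k)%:E.
Hypothesis Z_rate : forall a : cycle_index cI, 0 < cycle_rate (val a).
Hypothesis Z_indep : mutually_independent Z.

Definition pattern V : {ffun cycle_index cI -> nat} :=
  [ffun a => nat_of_bool (val a \in V)].

Lemma cycle_indicators_pattern w :
  cycle_indicators cI G w = pattern (cycles_in cI (G w)).
Proof.
by apply/ffunP => a; rewrite !ffunE /cycles_in finset.in_set /contains (valP a).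
Qed.

Lemma pattern_inj V V' : V \subset cI -> V' \subset cI -> pattern V = pattern V' -> V = V'.
Proof.
move=> VI VI' /ffunP H; apply/setP => E.
have [EI|nEI] := boolP (E \in cI).
  have := H (Sub E EI); rewrite !ffunE SubK.
  by case: (E \in V); case: (E \in V').
by rewrite (contraNF (fintype.subsetP VI E) nEI) (contraNF (fintype.subsetP VI' E) nEI).
Qed.

Let q_eq : d.-1%:R = d%:R - 1 :> R.
Proof. by rewrite -[in RHS](prednK (leq_trans (isT : 0 < 3)%N d_ge3)) -natr1 addrK. Qed.

Lemma cycle_rate_ge0 E : 0 <= cycle_rate E.
Proof. by rewrite /cycle_rate -q_eq divr_ge0 ?exprn_ge0. Qed.

Let p0 E := expR (- cycle_rate E).
Let p1 E := cycle_rate E * expR (- cycle_rate E).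
Let N : R := #|regular_graphs n d|%:R.
Let bound E := 1212 * (cycle_length E)%:R * (d%:R - 1) ^+ (cycle_length E + r - 1)
        / n%:R ^+ (cycle_length E + 1) : R.

Lemma resample_cycle_le E f : E \in cI -> (forall W, `|f W| <= 1) ->
  `|\sum_(g in regular_graphs n d) f (cycles_in cI g) -
    \sum_(g in regular_graphs n d) resample p0 p1 E f (cycles_in cI g)| <= bound E * N.
Proof.
move=> EI f1; have [size_nd r2n] := regime_bounds d_ge3 r_ge3 r_le d_le.
have [H0 H1] := poisson_weights_close (cycle_rate_ge0 E).
have := @resample_cycle_error R n d r cI cI_cycle d_ge3 r_ge3 size_nd p0 p1 (cycle_rate E) E f
  EI H0 H1 f1.
rewrite !graph_sum0.
have -> : @graph_count R n d finset.set0 = N.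
  by rewrite /graph_count graph_sum0 sumr_const.
move=> H; apply: le_trans H _; apply: ler_wpM2r; first exact: ler0n.
have [[c [Uc c3 Ec]] cr] := cI_cycle EI.
have c3' : (3 <= cycle_length E)%N by rewrite /cycle_length Ec card_cycle_edges.
have n0 : (0 < n)%N by apply: leq_trans d_le; rewrite expn_gt0 (leq_trans _ d_ge3).
rewrite /bound /cycle_rate -q_eq; apply: cycle_error_numeric => //.
- by rewrite (ler_nat R 2); case: d d_ge3.
- rewrite ler_nat; apply: leq_trans (leq_pred d) _; apply: leq_trans d_le.
  by rewrite -{1}(expn1 d) leq_pexp2l // (leq_trans _ d_ge3).
- exact: leq_trans c3'.
Qed.

Local Open Scope classical_set_scope.

Lemma graph_law A : measurable (cycle_indicators cI G @^-1` A) /\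
  P (cycle_indicators cI G @^-1` A) =
  ((\sum_(g in regular_graphs n d) (pattern (cycles_in cI g) \in A)%:R) / N)%:E.
Proof.
have -> : cycle_indicators cI G @^-1` A = G @^-1` [set g | A (pattern (cycles_in cI g))].
  by apply/seteqP; split=> w /=; rewrite cycle_indicators_pattern.
have [mB ->] := measure_preimage_fin P [set g | A (pattern (cycles_in cI g))] (fun g =>
  (G_unif g).1).
split=> //; rewrite (eq_bigr (fun g => (if g \in regular_graphs n d then N^-1 else 0)%:E));
  last first.
  by move=> g _; exact: (G_unif g).2.
rewrite sumEFin; congr EFin; rewrite mulr_suml.
rewrite [LHS]big_mkcond [RHS]big_mkcond /=; apply: eq_bigr => g _.
have -> : (g \in [set g | A (pattern (cycles_in cI g))]) = (pattern (cycles_in cI g) \in A).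
  by apply/idP/idP; rewrite !inE.
by case: (g \in _); case: (_ \in A); rewrite ?mul1r ?mul0r.
Qed.

Lemma pattern_law V : Q (joint_vector Z @^-1` [set pattern V]) =
  (pattern_weight p0 p1 (enum cI) V)%:E.
Proof.
rewrite (joint_law Z_indep).
rewrite (eq_bigr (fun a => (if val a \in V then p1 (val a) else p0 (val a))%:E)); last first.
  move=> a _; rewrite Z_law ffunE; congr EFin; rewrite /poisson_pmf Z_rate.
  by case: ifP => _ /=; rewrite ?fact0 ?expr0 ?expr1 invr1 mulr1 ?mul1r.
rewrite prodEFin; congr EFin; rewrite /pattern_weight.
rewrite [RHS](perm_big (map val (enum {: cycle_index cI}))) /=; last first.
  rewrite perm_sym; apply: uniq_perm;
    rewrite ?enum_uniq ?(map_inj_uniq val_inj) ?enum_uniq // => E.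
  rewrite mem_enum; apply/mapP/idP => [[a _ ->]|EI]; first exact: valP.
  by exists (Sub E EI); rewrite ?mem_enum ?SubK.
by rewrite big_map big_enum.
Qed.

(** Only the vectors of [A] with entries 0 and 1 are kept; mass of [Z] elsewhere is discarded, hence
    an inequality. *)
Lemma pattern_sum_le A :
  \sum_(V : {set edge_set n} | V \subset cI) pattern_weight p0 p1 (enum cI) V * (pattern V \in
    A)%:R
  <= fine (Q (joint_vector Z @^-1` A)).
Proof.
pose D : {pred {set edge_set n}} := [pred V : {set edge_set n} | (V \subset cI) && (pattern V
  \in A)].
have sub : \bigcup_(V in [set` enum D]) (joint_vector Z @^-1` [set pattern V]) `<=`
  joint_vector Z @^-1` A.
  move=> w [V /= + ->]; rewrite mem_enum !inE => /andP[_]; exact: set_mem.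
have fD : finite_set [set` enum D] by exact: finite_finset.
have mV V : measurable (joint_vector Z @^-1` [set pattern V]) by exact: measurable_joint.
have mU : measurable (\bigcup_(V in [set` enum D]) (joint_vector Z @^-1` [set pattern V])).
  exact: fin_bigcup_measurable.
have mA := measurable_joint Z A.
have := le_measure Q (mem_set mU) (mem_set mA) sub.
rewrite measure_fin_bigcup //; last first.
  apply/trivIsetP => V V' /=; rewrite !mem_enum !inE => /andP[VI _] /andP[VI' _] /eqP VV'.
  apply/seteqP; split=> // w /= [-> H]; apply: VV'; exact: pattern_inj.
rewrite -fsbig_seq ?enum_uniq //= big_enum /=.
rewrite (eq_bigr (fun V => (pattern_weight p0 p1 (enum cI) V)%:E)); last first.
  by move=> V _; exact: pattern_law.
rewrite sumEFin -[X in (_ <= X)%E](fineK (fin_num_measure Q _ mA)) lee_fin.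
apply: le_trans; rewrite [leRHS]big_mkcond [leLHS]big_mkcond /=; apply: ler_sum => V _.
by rewrite !inE; case: (V \subset cI); case: (_ \in A); rewrite ?mulr1 ?mulr0.
Qed.

Lemma one_sided A :
  fine (P (cycle_indicators cI G @^-1` A)) - fine (Q (joint_vector Z @^-1` A)) <=
  \sum_(E in cI) bound E.
Proof.
have [_ ->] := graph_law A; rewrite [fine _%:E]/=.
pose f V : R := (pattern V \in A)%:R.
pose w := \sum_(V : {set edge_set n} | V \subset cI) pattern_weight p0 p1 (enum cI) V * f V.
have f1 V : `|f V| <= 1 by rewrite /f ger0_norm ?lern1 ?leq_b1.
have p0_ge0 E : 0 <= p0 E by apply: expR_ge0.
have p1_ge0 E : 0 <= p1 E by rewrite mulr_ge0 ?expR_ge0 ?cycle_rate_ge0.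
have p_le1 E : p0 E + p1 E <= 1.
  have e0 := expR_gt0 (- cycle_rate E).
  have ee : expR (cycle_rate E) * expR (- cycle_rate E) = 1 by rewrite -expRD subrr expR0.
  rewrite -ee /p0 /p1 -[X in X + _]mul1r -mulrDl ler_pM2r //; exact: expR_ge1Dx.
(* With no regular graph every fibre of [G] would be null, contradicting total mass 1. *)
have N_gt0 : 0 < N.
  rewrite ltr0n lt0n; apply/eqP => N0.
  have [_] := measure_preimage_fin P [set: edge_set n] (fun g => (G_unif g).1).
  rewrite preimage_setT probability_setT big1; first by move=> /eqP; rewrite onee_eq0.
  move=> g _; rewrite (G_unif g).2; case: ifP => // gr.
  by move: (card0_eq N0 g); rewrite gr.
have [_] := @foldr_resample_error R _ p0 p1 p0_ge0 p1_ge0 p_le1 _ (mem (regular_graphs n d))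
  (cycles_in cI) (fun E => bound E * N) (enum cI) f
  (fun E g EI g1 => resample_cycle_le (etrans (esym (mem_enum _ _)) EI) g1) f1.
(* Once all cycles are resampled, nothing depends on the graph [g] any more: its cycles all lie in
   [cI], so the resampled function is the constant [w]. *)
rewrite [X in `|_ - X| <= _](eq_bigr (fun=> w)); last first.
  move=> g _; rewrite foldr_resample ?enum_uniq //; apply: eq_bigl => V.
  have -> : [set u in enum cI]%SET = cI by apply/setP => E; rewrite inE mem_enum.
  have -> : (cycles_in cI g :\: cI = finset.set0)%SET.
    by apply/eqP; rewrite finset.setD_eq0; apply/fintype.subsetP => E;
      rewrite finset.in_set => /andP[].
  by rewrite finset.setD_eq0.
rewrite sumr_const -mulr_natr big_enum /= -mulr_suml => H.
have H2 : (\sum_(g in regular_graphs n d) f (cycles_in cI g)) / N - w <= \sum_(E in cI) bound E.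
  rewrite lerBlDr ler_pdivrMr // mulrDl -lerBlDr.
  exact: le_trans (ler_norm _) H.
have := pattern_sum_le A; rewrite -/w.
by move: H2; rewrite /f; lra.
Qed.

(** The other sign is [one_sided] for the complement of [A]. *)
Theorem dTV_bound :
  dTV P Q (cycle_indicators cI G) (joint_vector Z) <= \sum_(E in cI) bound E.
Proof.
apply: ge_sup; first by eexists; exists set0.
move=> _ [A _ <-]; rewrite ler_norml; apply/andP; split; last exact: one_sided.
have [mPA _] := graph_law A; have mQA := measurable_joint Z A.
have EP : P (cycle_indicators cI G @^-1` (~` A)) =
    (1 - fine (P (cycle_indicators cI G @^-1` A)))%:E.
  by rewrite preimage_setC (probability_setC _ mPA) EFinB fineK ?fin_num_measure.
have EQ : Q (joint_vector Z @^-1` (~` A)) = (1 - fine (Q (joint_vector Z @^-1` A)))%:E.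
  by rewrite preimage_setC (probability_setC _ mQA) EFinB fineK ?fin_num_measure.
have := one_sided (~` A); rewrite EP EQ [fine (1 - _)%:E]/= [fine (1 - _)%:E in X in _ - X]/=.
move: (fine (P _)) (fine (Q _)) (\sum_(E in cI) _) => x y b; lra.
Qed.

End TotalVariation.

Theorem theorem7 (R : realType) :
  exists2 C : R, 0 < C &
  forall (n d r : nat) (cI : {set edge_set n})
    (dO : measure_display) (Omega : measurableType dO)
    (P : probability Omega R) (G : Omega -> edge_set n)
    (dO2 : measure_display) (Omega2 : measurableType dO2)
    (Q : probability Omega2 R) (Z : cycle_index cI -> {RV Q >-> nat}),
  (odd d -> ~~ odd n) ->
  (3 <= d)%N -> (3 <= r)%N ->
  r%:R <= n%:R `^ (10%:R^-1) :> R ->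
  d%:R <= n%:R `^ (3%:R^-1) :> R ->
  uniform_on P (regular_graphs n d) G ->
  (forall alpha, alpha \in cI -> is_cycle alpha /\ (cycle_length alpha <= r)%N) ->
  (forall alpha : cycle_index cI, is_poisson (Z alpha)) ->
  (forall alpha : cycle_index cI,
     ('E_Q[fun w => (Z alpha w)%:R] =
      ((d%:R - 1) ^+ cycle_length (val alpha)
         / (n ^_ cycle_length (val alpha))%:R)%:E)%E) ->
  mutually_independent Z ->
  dTV P Q (cycle_indicators cI G) (joint_vector Z) <=
    \sum_(alpha in cI)
      C * (cycle_length alpha)%:R * (d%:R - 1) ^+ (cycle_length alpha + r - 1)
        / n%:R ^+ (cycle_length alpha + 1).
Proof.
exists 1212; first by rewrite ltr0n.
move=> n d r cI dO Omega P G dO2 Omega2 Q Z _ d3 r3 rn dn Gu cIc Zp ZE Zi.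
have rates a : exists2 rate, 0 < rate & rate = cycle_rate R d (val a) /\
    forall k, Q ((Z a : Omega2 -> nat) @^-1` [set k])%classic = (poisson_pmf rate k)%:E.
  have [rate rate0 H] := Zp a; exists rate => //; split=> //.
  by have := ZE a; rewrite (poisson_expectation rate0 H) => -[].
apply: dTV_bound => //.
- exact: root_bound_pow rn.
- exact: root_bound_pow dn.
- by move=> a k; have [rate _ [<- ->]] := rates a.
- by move=> a; have [rate r0 [<- _]] := rates a.
Qed.
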